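(* Consider the parametric nonlinear program $\min_y f(x,y)$ s.t. $h(x,y)=0$, $g(x,y)\le0$, and let $\bar x,u\in\mathbb R^n$. Assume that the restricted inf-compactness holds at $\bar x$ in direction $u$ with compact set $\Omega_u$. Suppose that for each $y\in S(\bar x)\cap\Omega_u$ and every $(d^h,d^g)\in\mathrm{Im}D_xP(\bar x,y;u)$ there exists $v\in\mathbb R^m$ satisfying $$( * )\qquad d^h+\nabla_yh(\bar x,y)v=0,\qquad (d^g+\nabla_yg(\bar x,y)v)_j\le0\ \ \forall j\in\mathcal I_g(\bar x,y):=\{j: g_j(\bar x,y)=0\}.$$ Suppose that for each $y\in S(\bar x)\cap\Omega_u$ and every $w=(w^h,w^g)\in D(\bar x,y;u)$ one has $$\nabla_yh(\bar x,y)^T\mu+\nabla_yg(\bar x,y)^T\gamma=0,\ \ 0\le\gamma\perp g(\bar x,y),\ \ \gamma\perp w^g\ \Longrightarrow\ (\mu,\gamma)=(0,0),$$ where $$D(\bar x,y;u):=\left\{\big(d^h+\nabla_yh(\bar x,y)v,\ d^g+\nabla_yg(\bar x,y)v\big)\ :\ 0\ne(d^h,d^g,v)\in\mathrm{Im}D_xP(\bar x,y;u)\times\mathbb R^m,\ (d^h,d^g,v)\text{ satisfies }( * )\right\}.$$ Then $\mathcal F$ satisfies Robinson stability (RS) at $(\bar x,y)$ in direction $u$ for each $y\in S(\bar x)\cap\Omega_u$. Suppose in addition that for each $y\in S(\bar x)\cap\Omega_u$, each sign $s\in\{+1,-1\}$ and each $v$ satisfying $( * )$ with some $(d^h,d^g)\in\mathrm{Im}D_xP(\bar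 x,y;su)$ one has $$\left.\begin{array}{l}\nabla_yh(\bar x,y)^T\mu+\nabla_yg(\bar x,y)^T\gamma=0,\ \ 0\le\gamma\perp g(\bar x,y),\\ \mu\perp\nabla h(\bar x,y)(su,v),\ \ \gamma\perp\nabla g(\bar x,y)(su,v)\end{array}\right\}\Longrightarrow(\mu,\gamma)=(0,0).$$ Then $$\min_{y\in S(\bar x;u)\cap\Omega_u}\ \min_{\lambda\in\Lambda(\bar x,y)}\nabla_xL(\bar x,y,\lambda)u\ \le\ V'_-(\bar x;u)\ \le\ V'_+(\bar x;u)\ \le\ \min_{y\in S(\bar x;u)\cap\Omega_u}\ \max_{\lambda\in\Lambda(\bar x,y)}\nabla_xL(\bar x,y,\lambda)u .$$ Furthermore, if $\Lambda(\bar x,y)=\{\bar\lambda(y)\}$ is a singleton for every $y\in S(\bar x;u)\cap\Omega_u$, then $V$ is Hadamard directionally differentiable at $\bar x$ in direction $u$ and $$V'(\bar x;u)=\min_{y\in S(\bar x;u)\cap\Omega_u}\nabla_xL(\bar x,y,\bar\lambda(y))u .$$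
   Context: Setting: $f:\mathbb R^n\times\mathbb R^m\to\mathbb R$, $h:\mathbb R^n\times\mathbb R^m\to\mathbb R^{p_1}$, $g:\mathbb R^n\times\mathbb R^m\to\mathbb R^{p_2}$ are continuously differentiable; $P:=(h,g)$, $C:=\{0\}_{p_1}\times\mathbb R^{p_2}_-$, $p=p_1+p_2$. For $x\in\mathbb R^n$ put $\mathcal F(x):=\{y\in\mathbb R^m: P(x,y)\in C\}$, $V(x):=\inf\{f(x,y): y\in\mathcal F(x)\}$ (with $\inf\emptyset=+\infty$), $S(x):=\arg\min\{f(x,y): y\in\mathcal F(x)\}$, $L(x,y,\lambda):=f(x,y)+P(x,y)^T\lambda$. $(P_{\bar x})$ denotes the problem at $x=\bar x$. For a map $\phi(x,y)$ write $\nabla\phi(\bar x,y)(u,v):=\nabla_x\phi(\bar x,y)u+\nabla_y\phi(\bar x,y)v$. The notation $0\le\gamma\perp g$ means $\gamma\ge0$ componentwise and $\langle\gamma,g\rangle=0$. Multipliers: $\Lambda(\bar x,y):=\{\lambda\in N_C(P(\bar x,y)):\nabla_yf(\bar x,y)+\nabla_yP(\bar x,y)^T\lambda=0\}$, where, $C$ being convex, $N_C$ is the normal cone of convex analysis; i.e. $\lambda=(\mu,\gamma)$ with $\mu\in\mathbb R^{p_1}$, $0\le\gamma\perp g(\bar x,y)$. Image directional derivative: $\mathrm{Im}D_xP(\bar x,\bar y;u)$ is the closed cone $\{\alpha w:\alpha\ge0,\ \exists t_k\downarrow0,\ u^k\to u\text{ s.t. } w=\lim_k\frac{P(\bar x+t_ku^k,\bar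 y)-P(\bar x,\bar y)}{\|P(\bar x+t_ku^k,\bar y)-P(\bar x,\bar y)\|}\}$, with the convention that $0$ always belongs to it. Directional neighborhood: for $\varepsilon,\delta>0$, $\mathcal V_{\varepsilon,\delta}(d):=\{0\}\cup\{z\in\varepsilon\mathbb B\setminus\{0\}:\|z/\|z\|-d/\|d\|\|\le\delta\}$ if $d\ne0$, and $\mathcal V_{\varepsilon,\delta}(0):=\varepsilon\mathbb B$, where $\mathbb B$ is the open unit ball. Restricted inf-compactness at $\bar x$ in direction $u$ with compact set $\Omega_u\subseteq\mathbb R^m$: $V(\bar x)$ is finite and there are $\varepsilon,\delta>0$ such that $S(x)\cap\Omega_u\ne\emptyset$ for all $x\in\bar x+\mathcal V_{\varepsilon,\delta}(u)$ with $V(x)<V(\bar x)+\varepsilon$. Robinson stability (RS) of $\mathcal F$ at $(\bar x,\bar y)$, $\bar y\in\mathcal F(\bar x)$, in direction $u$: there are $\kappa\ge0$, $\varepsilon,\delta>0$ with $\mathrm{dist}(y,\mathcal F(x))\le\kappa\,\mathrm{dist}(P(x,y),C)$ for all $(x,y)\in(\bar x,\bar y)+\mathcal V_{\varepsilon,\delta}(u)\times\varepsilon\mathbb B$. Directional solution set: $S(\bar x;u):=\{y\in S(\bar x):\exists t_k\downarrow0,\ u^k\to u,\ y^k\to y,\ y^k\in S(\bar x+t_ku^k)\}$. Dini derivatives (Hadamard sense): $V'_+(\bar x;u)$ and $V'_-(\bar x;u)$ are respectively the $\limsup$ and $\liminf$ of $(V(\bar x+tu')-V(\bar x))/t$ as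 $t\downarrow0$, $u'\to u$. If both are finite and equal, $V$ is Hadamard directionally differentiable at $\bar x$ in direction $u$ and the common value is $V'(\bar x;u)$.
   Formalization: In the three-term estimate the inner min over multipliers may be −∞ and the outer min on the right is an infimum, since under the stated hypotheses these minima need not be attained; the inner max and the outer left min (in the extended reals) are attained. *)

(* Defs.v *)
From HB Require Import structures.
From mathcomp Require Import all_boot all_order all_algebra.
From mathcomp Require Import all_classical all_reals all_analysis.

Set Implicit Arguments.
Unset Strict Implicit.
Unset Printing Implicit Defensive.

Import Order.TTheory GRing.Theory Num.Theory.
Import numFieldNormedType.Exports.

Local Open Scope classical_set_scope.
Local Open Scope ring_scope.

(* Vectors of R^n are row vectors, with the topology of the library.  The norm
   the library puts on matrices is the max norm, so the Euclidean norm is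
   introduced here. *)
Section Euclidean.
Context {R : realType}.

Definition dotv {q : nat} (a b : 'rV[R]_q) : R := \sum_(i < q) a 0 i * b 0 i.

Definition enorm {q : nat} (a : 'rV[R]_q) : R := Num.sqrt (dotv a a).

(* In \bar R, so that the distance to the empty set is +oo. *)
Definition edistv {q : nat} (z : 'rV[R]_q) (A : set 'rV[R]_q) : \bar R :=
  ereal_inf [set (enorm (z - a))%:E | a in A].

(* N_A(z) in the sense of convex analysis, empty for z outside A. *)
Definition normal_cone {q : nat} (A : set 'rV[R]_q) (z : 'rV[R]_q) :
    set 'rV[R]_q :=
  [set l | A z /\ forall a, A a -> dotv l (a - z) <= 0].

Definition dir_nbhd {q : nat} (e delta : R) (d : 'rV[R]_q) : set 'rV[R]_q :=
  [set z | enorm z < e /\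
    (d <> 0 -> z <> 0 ->
     enorm ((enorm z)^-1 *: z - (enorm d)^-1 *: d) <= delta)].

Definition downto0 (t : nat -> R) : Prop :=
  (forall k, 0 < t k) /\ t @ \oo --> (0 : R).

End Euclidean.

(* The derivative exists everywhere and is continuous for the operator norm. *)
Definition cont_diff {R : realType} {E F : normedModType R} (phi : E -> F) :
    Prop :=
  (forall z, differentiable phi z) /\
  (forall z (e : R), 0 < e ->
     \forall w \near z, forall d, `|'d phi w d - 'd phi z d| <= e * `|d|).

(* Partial derivatives.  With row vectors the library's Jacobian is the
   transpose of the usual one: (nabla_x phi) u is u *m Jx phi x y, while
   (nabla_x phi)^T mu is mu *m (Jx phi x y)^T. *)
Section Partial.
Context {R : realType} {n m : nat}.

Definition Jx {q : nat} (phi : 'rV[R]_n * 'rV[R]_m -> 'rV[R]_q)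
    (x : 'rV[R]_n) (y : 'rV[R]_m) : 'M[R]_(n, q) :=
  'J (fun x' => phi (x', y)) x.

Definition Jy {q : nat} (phi : 'rV[R]_n * 'rV[R]_m -> 'rV[R]_q)
    (x : 'rV[R]_n) (y : 'rV[R]_m) : 'M[R]_(m, q) :=
  'J (fun y' => phi (x, y')) y.

Definition Jxy {q : nat} (phi : 'rV[R]_n * 'rV[R]_m -> 'rV[R]_q)
    (x : 'rV[R]_n) (y : 'rV[R]_m) (u : 'rV[R]_n) (v : 'rV[R]_m) : 'rV[R]_q :=
  u *m Jx phi x y + v *m Jy phi x y.

Definition grady (f : 'rV[R]_n * 'rV[R]_m -> R)
    (x : 'rV[R]_n) (y : 'rV[R]_m) : 'rV[R]_m :=
  \row_j 'd (fun y' => f (x, y')) y (delta_mx 0 j).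

(* The normalized difference must make sense, hence the nonvanishing
   increments. *)
Definition ImDx {q : nat} (P : 'rV[R]_n * 'rV[R]_m -> 'rV[R]_q)
    (x : 'rV[R]_n) (y : 'rV[R]_m) (u : 'rV[R]_n) : set 'rV[R]_q :=
  [set d | d = 0 \/
    exists (a : R) (w : 'rV[R]_q) (t : nat -> R) (us : nat -> 'rV[R]_n),
      [/\ 0 <= a /\ d = a *: w,
          downto0 t,
          us @ \oo --> u,
          forall k, P (x + t k *: us k, y) - P (x, y) <> 0 &
          (fun k => (enorm (P (x + t k *: us k, y) - P (x, y)))^-1 *:
                    (P (x + t k *: us k, y) - P (x, y))) @ \oo --> w]].

End Partial.

(* Lower and upper Dini derivatives in the Hadamard sense, in \bar R. *)
Section Dini.
Context {R : realType} {n : nat}.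
Variables (V : 'rV[R]_n -> \bar R) (x u : 'rV[R]_n).

Definition dini_quotient (p : R * 'rV[R]_n) : \bar R :=
  ((V (x + p.1 *: p.2) - V x) * (p.1^-1)%:E)%E.

Definition dini_upper : \bar R :=
  limf_esup dini_quotient (filter_prod (0 : R)^'+ (nbhs u)).

Definition dini_lower : \bar R :=
  limf_einf dini_quotient (filter_prod (0 : R)^'+ (nbhs u)).

Definition hadamard_derivative (r : R) : Prop :=
  dini_lower = r%:E /\ dini_upper = r%:E.

End Dini.

(* a is the minimum of A, attained. *)
Definition is_min {d : Order.disp_t} {T : porderType d} (A : set T) (a : T) :
    Prop :=
  A a /\ lbound A a.

Definition is_max {d : Order.disp_t} {T : porderType d} (A : set T) (a : T) :
    Prop :=
  A a /\ ubound A a.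

Section Program.
Context {R : realType} {n m p1 p2 : nat}.
Variables (f : 'rV[R]_n * 'rV[R]_m -> R)
          (h : 'rV[R]_n * 'rV[R]_m -> 'rV[R]_p1)
          (g : 'rV[R]_n * 'rV[R]_m -> 'rV[R]_p2).

Definition Pmap (z : 'rV[R]_n * 'rV[R]_m) : 'rV[R]_(p1 + p2) :=
  row_mx (h z) (g z).

Definition Cset : set 'rV[R]_(p1 + p2) :=
  [set z | lsubmx z = 0 /\ forall j, rsubmx z 0 j <= 0].

Definition feas (x : 'rV[R]_n) : set 'rV[R]_m := [set y | Cset (Pmap (x, y))].

Definition value (x : 'rV[R]_n) : \bar R :=
  ereal_inf [set (f (x, y))%:E | y in feas x].

Definition sol (x : 'rV[R]_n) : set 'rV[R]_m :=
  [set y | feas x y /\ forall y', feas x y' -> f (x, y) <= f (x, y')].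

Definition lagr (x : 'rV[R]_n) (y : 'rV[R]_m) (l : 'rV[R]_(p1 + p2)) : R :=
  f (x, y) + dotv (Pmap (x, y)) l.

(* nabla_x L(x,y,l) u *)
Definition lagr_dx (x : 'rV[R]_n) (y : 'rV[R]_m) (l : 'rV[R]_(p1 + p2))
    (u : 'rV[R]_n) : R :=
  'd (fun x' => lagr x' y l) x u.

Definition multipliers (x : 'rV[R]_n) (y : 'rV[R]_m) :
    set 'rV[R]_(p1 + p2) :=
  [set l | normal_cone Cset (Pmap (x, y)) l /\
           grady f x y + l *m (Jy Pmap x y)^T = 0].

Definition restricted_inf_compactness (x u : 'rV[R]_n) (Om : set 'rV[R]_m) :
    Prop :=
  [/\ compact Om, value x \is a fin_num &
    exists e delta : R, [/\ 0 < e, 0 < delta &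
      forall z, dir_nbhd e delta u z ->
        (value (x + z) < value x + e%:E)%E ->
        sol (x + z) `&` Om !=set0]].

Definition robinson_stable (x : 'rV[R]_n) (y : 'rV[R]_m) (u : 'rV[R]_n) :
    Prop :=
  feas x y /\
  exists kappa e delta : R, [/\ 0 <= kappa, 0 < e, 0 < delta &
    forall (dx : 'rV[R]_n) (dy : 'rV[R]_m),
      dir_nbhd e delta u dx -> enorm dy < e ->
      (edistv (y + dy) (feas (x + dx)) <=
       kappa%:E * edistv (Pmap (x + dx, y + dy)%R) Cset)%E].

Definition dir_sol (x u : 'rV[R]_n) : set 'rV[R]_m :=
  [set y | sol x y /\
    exists (t : nat -> R) (us : nat -> 'rV[R]_n) (ys : nat -> 'rV[R]_m),
      [/\ downto0 t, us @ \oo --> u, ys @ \oo --> y &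
          forall k, sol (x + t k *: us k) (ys k)]].

(* For d = (d^h, d^g), only the active inequality constraints are tested. *)
Definition lin_feasible (x : 'rV[R]_n) (y : 'rV[R]_m)
    (d : 'rV[R]_(p1 + p2)) (v : 'rV[R]_m) : Prop :=
  lsubmx d + v *m Jy h x y = 0 /\
  forall j, g (x, y) 0 j = 0 -> (rsubmx d + v *m Jy g x y) 0 j <= 0.

Definition Dset (x : 'rV[R]_n) (y : 'rV[R]_m) (u : 'rV[R]_n) :
    set ('rV[R]_p1 * 'rV[R]_p2) :=
  [set w | exists (d : 'rV[R]_(p1 + p2)) (v : 'rV[R]_m),
    [/\ ~ (d = 0 /\ v = 0),
        ImDx Pmap x y u d,
        lin_feasible x y d v &
        w = (lsubmx d + v *m Jy h x y, rsubmx d + v *m Jy g x y)]].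

(* nabla_y h^T mu + nabla_y g^T gamma = 0 and 0 <= gamma _|_ g. *)
Definition singular_multiplier (x : 'rV[R]_n) (y : 'rV[R]_m)
    (mu : 'rV[R]_p1) (gamma : 'rV[R]_p2) : Prop :=
  [/\ mu *m (Jy h x y)^T + gamma *m (Jy g x y)^T = 0,
      forall j, 0 <= gamma 0 j &
      dotv gamma (g (x, y)) = 0].

(* The values nabla_x L(x,y,l) u, l ranging over the multipliers at (x,y).  They
   live in \bar R because the multiplier set may be unbounded, in which case
   their infimum may be -oo. *)
Definition sensitivities (x u : 'rV[R]_n) (y : 'rV[R]_m) : set (\bar R) :=
  [set (lagr_dx x y l u)%:E | l in multipliers x y].

End Program.

(* Main.v *)
Require Import Defs.
From HB Require Import structures.
From mathcomp Require Import all_boot all_order all_algebra.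
From mathcomp Require Import all_classical all_reals all_analysis.
From mathcomp Require Import ring lra.

Set Implicit Arguments.
Unset Strict Implicit.
Unset Printing Implicit Defensive.

Import Order.TTheory GRing.Theory Num.Theory.
Import numFieldNormedType.Exports.

Local Open Scope classical_set_scope.
Local Open Scope ring_scope.

(* Stability: if it fails, Ekeland's principle applied to the distance to C gives
   infeasible points whose normalized residuals converge to a unit singular
   multiplier; the normalized increments converge to a critical direction on
   which this multiplier vanishes, contradicting the constraint qualification.

   Sensitivity: stability turns every solution v of the linearized constraints
   in a direction u0 into a curve of feasible points, along which f grows at rate
   f'(u0, v).  Moving away from xb in direction u bounds V'_+ from above, moving
   back from the solutions at xb + t u to xb bounds V'_- from below, and linear
   programming duality rewrites the best rate over v as a maximum, respectively
   a minimum, over the multipliers.  Minima over y and multipliers jointly are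
   attained because unbounded multipliers would produce a singular multiplier
   that the qualification excludes. *)


(** The stability proof rests on a clash of signs. Let [w] be the limit of the normalized increments
    of [P] and [l] the limit multiplier. Each product [l_i w_i] is nonnegative because residuals
    come from a projection, whereas solvability of the linearized system for [d] makes their sum
    nonpositive, [l] being orthogonal to the range of [D_y P]. So all products vanish, which also
    forces the rescaled residuals to 0 and makes [w] tangent.

    The sensitivity part is shaped by an asymmetry. A nonzero singular multiplier [l] has
    [dotv l ('d P (xb, y) (u, 0)) < 0], so the sensitivity decreases along it. Hence the maximum
    over multipliers is always attained, while the minimum is attained or [-oo], and both cases are
    carried along.

    Hadamard quotients converge along a product filter rather than along sequences. Limit statements
    are therefore made for filters, and compactness is used through ultrafilters, along which
    bounded families converge without passing to subsequences. *)

Section DotProduct.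
Context {R : realType}.
Implicit Types q : nat.

Lemma dotvC q (a b : 'rV[R]_q) : dotv a b = dotv b a.
Proof. by apply: eq_bigr => i _; rewrite mulrC. Qed.

Lemma dotvDr q (a b c : 'rV[R]_q) : dotv a (b + c) = dotv a b + dotv a c.
Proof. by rewrite -big_split; apply: eq_bigr => i _; rewrite mxE mulrDr. Qed.

Lemma dotvZr q k (a b : 'rV[R]_q) : dotv a (k *: b) = k * dotv a b.
Proof.
by rewrite /dotv mulr_sumr; apply: eq_bigr => i _; rewrite mxE mulrCA.
Qed.

Lemma dotvDl q (a b c : 'rV[R]_q) : dotv (a + b) c = dotv a c + dotv b c.
Proof. by rewrite ![dotv _ c]dotvC dotvDr. Qed.

Lemma dotvZl q k (a b : 'rV[R]_q) : dotv (k *: a) b = k * dotv a b.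
Proof. by rewrite ![dotv _ b]dotvC dotvZr. Qed.

Lemma dotvNr q (a b : 'rV[R]_q) : dotv a (- b) = - dotv a b.
Proof. by rewrite -scaleN1r dotvZr mulN1r. Qed.

Lemma dotvNl q (a b : 'rV[R]_q) : dotv (- a) b = - dotv a b.
Proof. by rewrite ![dotv _ b]dotvC dotvNr. Qed.

Lemma dotvBr q (a b c : 'rV[R]_q) : dotv a (b - c) = dotv a b - dotv a c.
Proof. by rewrite dotvDr dotvNr. Qed.

Lemma dotvBl q (a b c : 'rV[R]_q) : dotv (a - b) c = dotv a c - dotv b c.
Proof. by rewrite dotvDl dotvNl. Qed.

Lemma dotv0r q (a : 'rV[R]_q) : dotv a 0 = 0.
Proof. by rewrite -(scale0r 0) dotvZr mul0r. Qed.

Lemma dotv0l q (a : 'rV[R]_q) : dotv 0 a = 0.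
Proof. by rewrite dotvC dotv0r. Qed.

Lemma dotv_sumr q (I : finType) (a : 'rV[R]_q) (F : I -> 'rV[R]_q) :
  dotv a (\sum_i F i) = \sum_i dotv a (F i).
Proof.
elim/big_ind2 : _ => [|x1 y1 x2 y2 <- <-|//]; first exact: dotv0r.
by rewrite dotvDr.
Qed.

Lemma dotv_mulmx q r (v : 'rV[R]_q) (M : 'M[R]_(q, r)) (l : 'rV[R]_r) :
  dotv (v *m M) l = dotv v (l *m M^T).
Proof.
rewrite /dotv; under eq_bigr do rewrite mxE mulr_suml.
rewrite exchange_big; apply: eq_bigr => i _; rewrite mxE mulr_sumr.
by apply: eq_bigr => j _; rewrite mxE; ring.
Qed.

Lemma dotv_row_mx q r (a c : 'rV[R]_q) (b d : 'rV[R]_r) :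
  dotv (row_mx a b) (row_mx c d) = dotv a c + dotv b d.
Proof.
rewrite /dotv big_split_ord; congr (_ + _); apply: eq_bigr => i _.
  by rewrite !row_mxEl.
by rewrite !row_mxEr.
Qed.

Lemma dotv_delta q (a : 'rV[R]_q) i : dotv a (delta_mx 0 i) = a 0 i.
Proof.
rewrite /dotv (bigD1 i) //= mxE !eqxx mulr1 big1 ?addr0 // => j ji.
by rewrite mxE (negbTE ji) andbF mulr0.
Qed.

Lemma dotv_eq0 q (a : 'rV[R]_q) : (forall b, dotv a b = 0) -> a = 0.
Proof. by move=> a0; apply/rowP => i; rewrite mxE -dotv_delta a0. Qed.

Lemma dotvv_ge0 q (a : 'rV[R]_q) : 0 <= dotv a a.
Proof. by apply: sumr_ge0 => i _; rewrite -expr2 sqr_ge0. Qed.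

Lemma dotvv_eq0 q (a : 'rV[R]_q) : dotv a a = 0 -> a = 0.
Proof.
move=> a0; apply/rowP => i; apply/eqP; rewrite mxE -sqrf_eq0 expr2.
have /psumr_eq0P : forall i, true -> 0 <= a 0 i * a 0 i.
  by move=> j _; rewrite -expr2 sqr_ge0.
by move=> /(_ a0) ->.
Qed.

Lemma enorm_ge0 q (a : 'rV[R]_q) : 0 <= enorm a.
Proof. exact: sqrtr_ge0. Qed.

Lemma enorm_sqr q (a : 'rV[R]_q) : enorm a ^+ 2 = dotv a a.
Proof. by rewrite sqr_sqrtr // dotvv_ge0. Qed.

Lemma enorm0 q : enorm (0 : 'rV[R]_q) = 0.
Proof. by rewrite /enorm dotv0r sqrtr0. Qed.

Lemma enorm_eq0 q (a : 'rV[R]_q) : enorm a = 0 -> a = 0.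
Proof. by move=> a0; apply: dotvv_eq0; rewrite -enorm_sqr a0 expr0n. Qed.

Lemma enorm_gt0 q (a : 'rV[R]_q) : a <> 0 -> 0 < enorm a.
Proof.
by move=> a0; rewrite lt0r enorm_ge0 andbT; apply/eqP => /enorm_eq0.
Qed.

Lemma enormZ q k (a : 'rV[R]_q) : enorm (k *: a) = `|k| * enorm a.
Proof.
by rewrite /enorm dotvZl dotvZr mulrA -expr2 sqrtrM ?sqr_ge0 // sqrtr_sqr.
Qed.

Lemma enormN q (a : 'rV[R]_q) : enorm (- a) = enorm a.
Proof. by rewrite -scaleN1r enormZ normrN normr1 mul1r. Qed.

Lemma coord_le_norm q (a : 'rV[R]_q) i : `|a 0 i| <= `|a|.
Proof.
rewrite [leRHS]/Num.norm /= mx_normrE; apply/bigmax_geP; right.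
by exists (0, i).
Qed.

Lemma rV_norm_le q (a : 'rV[R]_q) (e : R) :
  0 <= e -> (forall i, `|a 0 i| <= e) -> `|a| <= e.
Proof.
move=> e0 ae; rewrite [leLHS]/Num.norm /= mx_normrE; apply/bigmax_leP; split=> //.
by case=> i j _ /=; rewrite ord1.
Qed.

Lemma norm_le_enorm q (a : 'rV[R]_q) : `|a| <= enorm a.
Proof.
apply: rV_norm_le => [|i]; first exact: enorm_ge0.
rewrite -sqrtr_sqr ler_wsqrtr // /dotv (bigD1 i) //= -expr2 lerDl.
by apply: sumr_ge0 => j _; rewrite -expr2 sqr_ge0.
Qed.

Lemma dotv_le_norm q (a b : 'rV[R]_q) : `|dotv a b| <= q%:R * (`|a| * `|b|).
Proof.
apply: le_trans (ler_norm_sum _ _ _) _.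
have -> : q%:R * (`|a| * `|b|) = \sum_(i < q) (`|a| * `|b|).
  by rewrite sumr_const card_ord mulr_natl.
by apply: ler_sum => i _; rewrite normrM ler_pM // coord_le_norm.
Qed.

(** A crude constant suffices: it ends up only in the Robinson modulus [m%:R / e]. *)
Lemma enorm_le_norm q (a : 'rV[R]_q) : enorm a <= q%:R * `|a|.
Proof.
case: q a => [|q] a.
  by rewrite mul0r [a]thinmx0 enorm0.
rewrite -[leRHS]ger0_norm ?mulr_ge0 // -sqrtr_sqr ler_wsqrtr //.
apply: le_trans (ler_norm _) (le_trans (dotv_le_norm _ _) _).
rewrite -expr2 exprMn ler_wpM2r ?sqr_ge0 // expr2 ler_peMl //.
by rewrite ler1n.
Qed.

Lemma norm_row_mx_le q r (a : 'rV[R]_q) (b : 'rV[R]_r) e :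
  `|a| <= e -> `|b| <= e -> `|row_mx a b| <= e.
Proof.
move=> ae be; apply: rV_norm_le => [|i]; first exact: le_trans ae.
case: (split_ordP i) => j ->; rewrite ?row_mxEl ?row_mxEr.
  exact: le_trans (coord_le_norm _ _) ae.
exact: le_trans (coord_le_norm _ _) be.
Qed.

End DotProduct.

Section RowLimits.
Context {R : realType} {I : Type} {F : set_system I} {FF : Filter F}.

Lemma cvg_coord q (a : I -> 'rV[R]_q) (l : 'rV[R]_q) i :
  a @ F --> l -> (fun k => a k 0 i) @ F --> l 0 i.
Proof.
move=> al; have := @coord_continuous R 1 q 0 i l.
by move=> /(cvg_comp _ _ al).
Qed.

Lemma cvg_rV q (a : I -> 'rV[R]_q) (l : 'rV[R]_q) :
  (forall i, (fun k => a k 0 i) @ F --> l 0 i) -> a @ F --> l.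
Proof.
move=> al; apply/cvgrPdist_le => e e0.
have : \forall k \near F, forall i, `|l 0 i - a k 0 i| <= e.
  apply: filter_forall => i; have /cvgrPdist_le := al i; exact.
apply: filterS => k ke; apply: rV_norm_le; first exact: ltW.
by move=> i; rewrite !mxE.
Qed.

Lemma cvg_dotv q (a b : I -> 'rV[R]_q) (la lb : 'rV[R]_q) :
  a @ F --> la -> b @ F --> lb -> (fun k => dotv (a k) (b k)) @ F --> dotv la lb.
Proof.
move=> al bl; rewrite /dotv; apply: cvg_big => [|i _].
  by apply: add_continuous.
by apply: cvgM; apply: cvg_coord.
Qed.

Lemma cvg_enorm q (a : I -> 'rV[R]_q) (la : 'rV[R]_q) :
  a @ F --> la -> (fun k => enorm (a k)) @ F --> enorm la.
Proof.
by move=> al; apply: cvg_comp (cvg_dotv al al) (@sqrt_continuous _ _).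
Qed.

Lemma cvg_norm0 (V : normedModType R) (a : I -> V) (e : I -> R) :
  e @ F --> 0 -> (\forall k \near F, `|a k| <= e k) -> a @ F --> 0.
Proof.
move=> e0 ae; apply/cvgr0Pnorm_le => d d0.
move/cvgr0Pnorm_le : e0 => /(_ _ d0); apply: filterS2 ae => k h1 h2.
exact: le_trans h1 (le_trans (ler_norm _) h2).
Qed.

End RowLimits.

(** * Compactness through ultrafilters *)

Section UltraLimits.
Context {R : realType} {I : Type} {U : set_system I} {UU : UltraFilter U}.

Lemma ultra_setVsetC (A : set I) : U A \/ U (~` A).
Proof. exact: in_ultra_setVsetC. Qed.

Lemma ultra_fmap (T : Type) (f : I -> T) : UltraFilter (f @ U).
Proof.
split; first exact: fmap_proper_filter.
move=> G GG sUG; rewrite predeqE => A; split=> [GA|]; last exact: sUG.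
have [//|UnA] := ultra_setVsetC (f @^-1` A).
have [x []] := @filter_ex _ G _ _ (filterI GA (sUG (~` A) UnA)).
by [].
Qed.

(** Stands in for the extraction of subsequences: several families converge along one and the same
    [U], with no reindexing. *)
Lemma ultra_cvg_compact (T : topologicalType) (K : set T) (a : I -> T) :
  compact K -> (\forall k \near U, K (a k)) -> exists2 l, K l & a @ U --> l.
Proof.
rewrite compact_ultra => cK UK.
by have [l [Kl al]] := cK _ (ultra_fmap a) UK; exists l.
Qed.

Lemma ultra_cvg_rV q (a : I -> 'rV[R]_q) (M : R) :
  (\forall k \near U, `|a k| <= M) -> exists l : 'rV[R]_q, a @ U --> l.
Proof.
move=> aM; suff cB : compact [set x : 'rV[R]_q | `|x| <= M].
  by have [l _ al] := ultra_cvg_compact cB aM; exists l.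
apply: bounded_closed_compact.
  by exists M; split; [exact: num_real|move=> x Mx y /= /le_trans -> //; exact: ltW].
have -> : [set x : 'rV[R]_q | `|x| <= M] = Num.norm @^-1` [set x : R | x <= M] by [].
apply: closed_comp; last exact: closed_le.
by move=> x _; exact: norm_continuous.
Qed.

End UltraLimits.

(** * Theorems of the alternative and polyhedral cones *)

Section Farkas.
Context {R : realType}.

(* Bartl's induction on the number of constraints. *)
Lemma farkas_mixed k N (e : 'I_N -> bool) (a : 'I_N -> 'rV[R]_k) (b : 'rV[R]_k) :
  (forall x, (forall i, if e i then dotv (a i) x = 0 else dotv (a i) x <= 0) ->
     dotv b x <= 0) ->
  exists2 l : 'I_N -> R, (forall i, ~~ e i -> 0 <= l i) & b = \sum_i l i *: a i.
Proof.
elim: N e a b => [|N IH] e a b ab.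
  exists (fun=> 0) => //; rewrite big_ord0; apply: dotvv_eq0; apply/eqP.
  rewrite eq_le dotvv_ge0 andbT; apply: ab; case=> i /= lti; by [].
pose e' i := e (lift ord0 i); pose a' i := a (lift ord0 i).
pose feasible x := forall i, if e' i then dotv (a' i) x = 0 else dotv (a' i) x <= 0.
have [all_le|] := pselect (forall x, feasible x -> dotv b x <= 0).
  have [l l0 bl] := IH e' a' b all_le.
  exists (fun i => oapp l 0 (unlift ord0 i)) => [i|].
    by case: unliftP => [j ->|->] //= ej; exact: l0.
  rewrite big_ord_recl unlift_none scale0r add0r bl.
  by apply: eq_bigr => i _; rewrite liftK.
move/existsNP => [z /not_implyP [zfeas /negP]]; rewrite -ltNge => bz.
pose s := dotv (a ord0) z.
(* Otherwise [z] would satisfy constraint 0 as well, and [0 < dotv b z] would contradict [ab]. *)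
have s_neq : if e ord0 then s != 0 else 0 < s.
  case e0: (e ord0).
    apply/eqP => s0; move: bz; apply/negP; rewrite -leNgt; apply: ab => i.
    by case: (unliftP ord0 i) => [j ->|->]; [exact: zfeas|rewrite e0].
  rewrite ltNge; apply/negP => s0.
  move: bz; apply/negP; rewrite -leNgt; apply: ab => i.
  by case: (unliftP ord0 i) => [j ->|->]; [exact: zfeas|rewrite e0].
have s0 : s != 0 by move: s_neq; case: (e ord0) => // /lt0r_neq0.
(* Transpose of the projection along [z] onto the hyperplane orthogonal to [a ord0]. On that
   hyperplane constraint 0 holds with equality, so the reduced system has one constraint fewer. *)
pose red c := c - (dotv c z / s) *: a ord0.
have redE c x : dotv (red c) x = dotv c (x - (dotv (a ord0) x / s) *: z).
  by rewrite /red dotvBl dotvBr dotvZl dotvZr; field.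
have [|l l0 bl] := IH e' (fun i => red (a' i)) (red b).
  move=> x xfeas; rewrite redE; apply: ab => i.
  case: (unliftP ord0 i) => [j ->|->].
    by have := xfeas j; rewrite redE.
  rewrite dotvBr dotvZr -/s divfK // subrr; by case: ifP.
(* The coefficient of [a ord0] is forced by undoing the reduction. When constraint 0 is an
   inequality it is nonnegative, because [dotv b z] and [s] are positive while each
   [l i * dotv (a' i) z] is at most 0. *)
exists (fun i => oapp l ((dotv b z - \sum_i l i * dotv (a' i) z) / s)
                   (unlift ord0 i)) => [i|].
  case: (unliftP ord0 i) => [j ->|->]; rewrite ?liftK ?unlift_none /=; first exact: l0.
  move=> /negbTE e0; move: s_neq; rewrite e0 => s_gt0.
  rewrite divr_ge0 ?(ltW s_gt0) // subr_ge0 (le_trans _ (ltW bz)) //.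
  apply: sumr_le0 => j _; have := zfeas j; case: ifP => [_ ->|/negbT ej].
    by rewrite mulr0.
  by move=> ?; rewrite mulr_ge0_le0 // l0.
pose S := \sum_i l i * dotv (a' i) z.
have Er : red b = \sum_i l i *: a' i - (S / s) *: a ord0.
  rewrite bl /red; under eq_bigr do rewrite scalerBr scalerA.
  rewrite sumrB -scaler_suml /S mulr_suml; congr (_ - _ *: _).
  by apply: eq_bigr => i _; rewrite mulrA.
rewrite -{1}[b](subrK ((dotv b z / s) *: a ord0)) -/(red b) Er.
rewrite big_ord_recl unlift_none /= mulrBl scalerBl -/S addrAC -addrA addrC.
congr (_ + _); apply: eq_bigr => i _; by rewrite liftK.
Qed.

(** For [z] in the product of [{0}] (coordinates marked by [e]) and of half-lines of nonpositive
    numbers, this is the tangent cone at [z], and [polar_cone] below is the normal cone. Both are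
    written by coordinates, so that signs and limits can be handled termwise. *)
Definition tangent_cone q (e : 'I_q -> bool) (z : 'rV[R]_q) : set 'rV[R]_q :=
  [set w | forall i, if e i then w 0 i = 0 else z 0 i = 0 -> w 0 i <= 0].

Definition polar_cone q (e : 'I_q -> bool) (z : 'rV[R]_q) : set 'rV[R]_q :=
  [set l | forall i, e i \/ 0 <= l 0 i /\ l 0 i * z 0 i = 0].

(** The termwise form is kept because a vanishing or nonnegative total then forces every term to be
    0. *)
Lemma polar_termwise q (e : 'I_q -> bool) (z l w : 'rV[R]_q) :
  polar_cone e z l -> tangent_cone e z w -> forall i, l 0 i * w 0 i <= 0.
Proof.
move=> lz wz i; have := wz i; case: ifPn => [_ ->|ei]; first by rewrite mulr0.
case: (lz i) => [/(negP ei)//|[l0 /eqP]]; rewrite mulf_eq0 => /orP[/eqP ->|/eqP z0].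
  by rewrite mul0r.
by move=> /(_ z0) ?; rewrite mulr_ge0_le0.
Qed.

Lemma polar_dotv_le0 q (e : 'I_q -> bool) (z l w : 'rV[R]_q) :
  polar_cone e z l -> tangent_cone e z w -> dotv l w <= 0.
Proof. by move=> lz wz; apply: sumr_le0 => i _; exact: polar_termwise lz wz i. Qed.

Lemma polarD q (e : 'I_q -> bool) (z l l' : 'rV[R]_q) :
  polar_cone e z l -> polar_cone e z l' -> polar_cone e z (l + l').
Proof.
move=> lz lz' i; case: (lz i) => [|[h1 h2]]; first by left.
case: (lz' i) => [|[h3 h4]]; first by left.
by right; rewrite mxE addr_ge0 // mulrDl h2 h4 addr0.
Qed.

Lemma polarZ q (e : 'I_q -> bool) (z l : 'rV[R]_q) (t : R) :
  0 <= t -> polar_cone e z l -> polar_cone e z (t *: l).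
Proof.
move=> t0 lz i; case: (lz i) => [|[h1 h2]]; first by left.
by right; rewrite mxE mulr_ge0 // -mulrA h2 mulr0.
Qed.

(* LP duality for min {c v | q + v M in T}, by homogenization. *)
Lemma farkas_tangent m q (e : 'I_q -> bool) (z p : 'rV[R]_q) (M : 'M[R]_(m, q))
    (G : 'rV[R]_m) (c : R) :
  (exists2 v, tangent_cone e z (p + v *m M) & dotv G v <= c) \/
  (exists l, [/\ polar_cone e z l, l *m M^T = 0 & 0 < dotv l p]) \/
  (exists l, [/\ polar_cone e z l, G + l *m M^T = 0 & c < dotv l p]).
Proof.
have [|nv] := pselect (exists2 v, tangent_cone e z (p + v *m M) & dotv G v <= c).
  by left.
right.
(* Inactive inequalities get a zero row, so that the constraints remain indexed by ['I_q]. *)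
pose act i := e i || (z 0 i == 0).
pose hrow i : 'rV[R]_(1 + m) := if act i then
  row_mx (p 0 i)%:M (col i M)^T else 0.
(* Homogenization by a scalar [s] placed before [v]: the rows say [dotv G v <= c * s], [0 <= s], and
   tangency of [s *: p + v *m M]. The functional to bound is [s] itself, since a solution with
   [0 < s], divided by [s], would realize the first alternative. *)
pose a (i : 'I_q.+2) : 'rV[R]_(1 + m) :=
  match unlift ord0 i with
  | None => row_mx (- c)%:M G
  | Some j => match unlift ord0 j with
              | None => row_mx (- 1)%:M 0
              | Some k => hrow k
              end
  end.
pose e2 (i : 'I_q.+2) : bool :=
  match unlift ord0 i with
  | None => false
  | Some j => match unlift ord0 j with
              | None => false
              | Some k => e k
              end
  end.
have dotS s t : dotv (s%:M : 'rV[R]_1) (t%:M) = s * t.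
  by rewrite /dotv big_ord1 !mxE eqxx !mulr1n.
have hrowE i s v : act i -> dotv (hrow i) (row_mx s%:M v) = s * p 0 i + (v *m M) 0 i.
  move=> ai; rewrite /hrow ai dotv_row_mx dotS mulrC; congr (_ + _).
  by rewrite mxE /dotv; apply: eq_bigr => j _; rewrite !mxE mulrC.
have dotrow t (g : 'rV[R]_m) s v :
    dotv (row_mx t%:M g : 'rV[R]_(1 + m)) (row_mx s%:M v) = t * s + dotv g v.
  by rewrite dotv_row_mx dotS.
have [x|l l0 El] := farkas_mixed (e := e2) (a := a) (b := row_mx 1%:M 0).
  have xE : x = row_mx (lsubmx x 0 0)%:M (rsubmx x).
    by rewrite -mx11_scalar hsubmxK.
  rewrite xE; move: (lsubmx x 0 0) (rsubmx x) => s v {xE x} fx.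
  rewrite dotrow dotv0l mul1r addr0 leNgt; apply/negP => s0.
  apply: nv; exists (s^-1 *: v) => [i|].
    have E : (p + s^-1 *: v *m M) 0 i = s^-1 * (s * p 0 i + (v *m M) 0 i).
      by rewrite mxE -scalemxAl mxE mulrDr mulKf // lt0r_neq0.
    have := fx (lift ord0 (lift ord0 i)); rewrite /a /e2 !liftK E.
    case ei: (e i); last move=> H z0.
      by rewrite hrowE /act ?ei // => ->; rewrite mulr0.
    rewrite hrowE /act ?ei ?z0 ?eqxx // in H.
    by rewrite mulr_ge0_le0 // invr_ge0 ltW.
  have := fx ord0; rewrite /a /e2 unlift_none dotrow dotvZr => H.
  by rewrite mulrC ler_pdivrMr // -subr_le0 addrC -mulNr.
pose mu := l ord0; pose nu := l (lift ord0 ord0).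
pose L := \row_(i < q) if act i then l (lift ord0 (lift ord0 i)) else 0.
have mu0 : 0 <= mu by apply: l0; rewrite /e2 unlift_none.
have nu0 : 0 <= nu by apply: l0; rewrite /e2 liftK unlift_none.
have polL : polar_cone e z L.
  move=> i; case ei : (e i); [by left|right]; rewrite !mxE /act ei /=.
  case: eqP => [->|_]; last by rewrite mul0r.
  by rewrite mulr0; split=> //; apply: l0; rewrite /e2 !liftK ei.
have EL (s : R) (v : 'rV[R]_m) : s = mu * (- c * s + dotv G v) - nu * s
              + (s * dotv L p + dotv L (v *m M)).
  have := congr1 (fun r => dotv r (row_mx s%:M v)) El.
  rewrite dotrow mul1r dotv0l addr0 => {1}->.
  rewrite dotvC dotv_sumr !big_ord_recl /= !dotvZr ![dotv (row_mx _ v) _]dotvC.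
  rewrite {1 2}/a liftK !unlift_none !dotrow dotv0l addr0 addrA -/mu -/nu.
  rewrite mulN1r mulrN; congr (_ + _).
  have -> : s * dotv L p + dotv L (v *m M) =
            \sum_i (s * (L 0 i * p 0 i) + L 0 i * (v *m M) 0 i).
    by rewrite /dotv mulr_sumr -big_split.
  apply: eq_bigr => i _ /=.
  rewrite dotvZr dotvC /a !liftK mxE; case: ifPn => [ai|nai].
    by rewrite hrowE //; ring.
  by rewrite /hrow (negbTE nai) dotv0l; ring.
have E1 : 1 = - (mu * c) - nu + dotv L p.
  by rewrite {1}(EL 1 0) dotv0r mul0mx dotv0r; ring.
have E2 : mu *: G + L *m M^T = 0.
  apply: dotv_eq0 => v; rewrite dotvDl dotvZl [dotv (_ *m _) v]dotvC -dotv_mulmx.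
  by rewrite [RHS](EL 0 v) [dotv L (v *m M)]dotvC; ring.
(* [mu] is the weight of the objective row. If it vanishes, the certificate concerns the tangency
   constraints alone; if not, dividing by it gives a dual solution, and the strict inequality comes
   from the constant 1 in [E1]. *)
have [mu_eq0|mu_neq0] := eqVneq mu 0.
  left; exists L; split=> //; first by rewrite -E2 mu_eq0 scale0r add0r.
  by rewrite mu_eq0 in E1; lra.
have mu_gt0 : 0 < mu by rewrite lt0r mu_neq0.
right; exists (mu^-1 *: L); split.
- by apply: polarZ; rewrite ?invr_ge0.
- by rewrite -scalemxAl -[G in G + _](scalerK mu_neq0) -scalerDr E2 scaler0.
- by rewrite dotvZl mulrC ltr_pdivlMr //; lra.
Qed.
End Farkas.

(** * Strict differentiability of continuously differentiable maps *)

Section StrictDifferentiability.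
Context {R : realType}.

Lemma diff_line (E : normedModType R) (b v : E) (s r : R) :
  differentiable (fun s : R => b + s *: v) s /\
  'd (fun s : R => b + s *: v) s r = r *: v.
Proof.
have -> : (fun s : R => b + s *: v) = cst b + *:%R^~ v by [].
have [d1 d1E] := is_diff_scalel s v.
split; first exact: differentiableD (differentiable_cst b s) d1.
have E1 := congr1 (fun k => k r) (diffD (differentiable_cst b s) d1).
have E2 := congr1 (fun k => k r) (diff_cst b s).
have E3 := congr1 (fun k => k r) d1E.
exact: etrans E1 (etrans (f_equal2 +%R E2 E3) (add0r _)).
Qed.

Lemma mean_value_segment (E : normedModType R) (phi : E -> R) (a b : E) :
  (forall z, differentiable phi z) ->
  exists2 c, 0 < c < 1 & phi a - phi b = 'd phi (b + c *: (a - b)) (a - b).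
Proof.
move=> dphi; pose line (s : R) := b + s *: (a - b).
have dline s : differentiable line s by have [] := diff_line b (a - b) s 0.
have dpsi s : is_derive s (1 : R) (phi \o line) ('d phi (line s) (a - b)).
  have dcomp := differentiable_comp (dline s) (dphi (line s)).
  apply: DeriveDef; first exact: diff_derivable.
  rewrite deriveE // diff_comp //=; congr ('d phi _ _).
  by have [_ ->] := diff_line b (a - b) s 1; rewrite scale1r.
have cline : {within `[0, 1], continuous (phi \o line)}.
  apply: continuous_subspaceT => s; apply: differentiable_continuous.
  exact: differentiable_comp.
have [c c01] := MVT ltr01 (fun s _ => dpsi s) cline.
rewrite /line /= scale0r addr0 scale1r subr0 mulr1 [b + (a - b)]addrC subrK => E0.
by exists c; rewrite ?in_itv in c01.
Qed.

(** Both endpoints move, so differentiability at [z] is not enough: the mean value theorem moves the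
    derivative to an intermediate point, where continuity compares it with the one at [z]. *)
Lemma strict_diff_real (E : normedModType R) (phi : E -> R) (I : Type)
    (F : set_system I) (FF : Filter F) (a b : I -> E) (z : E) (e : R) :
  cont_diff phi -> a @ F --> z -> b @ F --> z -> 0 < e ->
  \forall k \near F,
    `|phi (a k) - phi (b k) - 'd phi z (a k - b k)| <= e * `|a k - b k|.
Proof.
move=> [dphi cphi] az bz e0.
have /nbhs_ballP [d /= d0 ball_e] := cphi z e e0.
move/cvgrPdist_lt : az => /(_ _ d0) az; move/cvgrPdist_lt : bz => /(_ _ d0) bz.
apply: filterS2 az bz => k ak bk.
have [c /andP[c0 c1] ->] := mean_value_segment (a k) (b k) dphi.
apply: ball_e; rewrite -ball_normE /ball_ /=.
(* The intermediate point is a convex combination of [a k] and [b k], hence within [d] of [z]. *)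
have -> : z - (b k + c *: (a k - b k)) = (1 - c) *: (z - b k) + c *: (z - a k).
  rewrite scalerBl scale1r !scalerBr opprD -!addrA; congr (_ + (_ + _)); rewrite ?opprB.
  by rewrite addrA subrK.
apply: le_lt_trans (ler_normD _ _) _; rewrite !normrZ !gtr0_norm ?subr_gt0 //.
have -> : d = (1 - c) * d + c * d by ring.
by rewrite ltrD // ltr_pM2l // subr_gt0.
Qed.

Lemma diff_coord (E : normedModType R) q (phi : E -> 'rV[R]_q) (z v : E) i :
  differentiable phi z ->
  differentiable (fun w => phi w 0 i) z /\
  'd (fun w => phi w 0 i) z v = 'd phi z v 0 i.
Proof.
move=> dphi; pose c (M : 'rV[R]_q) := M 0 i : R.
have c_lin : linear c by move=> k x y; rewrite /c !mxE.
pose cL : {linear 'rV[R]_q -> R} := HB.pack c (GRing.isLinear.Build _ _ _ _ c c_lin).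
have cc : continuous cL by exact: coord_continuous.
have dc w : differentiable cL w by exact: linear_differentiable.
split; first exact: (differentiable_comp (g := cL)).
have Ec := diff_comp (g := cL) dphi (dc (phi z)).
by rewrite (diff_lin _ cc) in Ec; exact: (congr1 (fun k => k v) Ec).
Qed.

Lemma cont_diff_coord (E : normedModType R) q (phi : E -> 'rV[R]_q) i :
  cont_diff phi -> cont_diff (fun w => phi w 0 i).
Proof.
move=> [dphi cphi]; split=> [z|z e e0].
  by have [] := diff_coord 0 i (dphi z).
apply: filterS (cphi z e e0) => w H v; apply: le_trans (H v).
have [_ ->] := diff_coord v i (dphi w); have [_ ->] := diff_coord v i (dphi z).
by apply: le_trans (coord_le_norm _ i); rewrite !mxE.
Qed.

(** The mean value theorem being scalar, the estimate is made for each of the finitely many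
    coordinates; the max norm reassembles them without changing [e]. *)
Lemma strict_diff (E : normedModType R) q (phi : E -> 'rV[R]_q) (I : Type)
    (F : set_system I) (FF : Filter F) (a b : I -> E) (z : E) (e : R) :
  cont_diff phi -> a @ F --> z -> b @ F --> z -> 0 < e ->
  \forall k \near F,
    `|phi (a k) - phi (b k) - 'd phi z (a k - b k)| <= e * `|a k - b k|.
Proof.
move=> Cphi az bz e0.
have : \forall k \near F, forall i : 'I_q,
    `|phi (a k) 0 i - phi (b k) 0 i - 'd phi z (a k - b k) 0 i| <= e * `|a k - b k|.
  apply: filter_forall => i.
  have := strict_diff_real FF (cont_diff_coord i Cphi) az bz e0.
  apply: filterS => k; have [_ ->] := diff_coord (a k - b k) i (Cphi.1 z).
  by [].
apply: filterS => k H; apply: rV_norm_le => [|i]; first by rewrite mulr_ge0 // ltW.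
by apply: le_trans (H i); rewrite !mxE.
Qed.

Lemma cont_diff_continuous (E F : normedModType R) (phi : E -> F) :
  cont_diff phi -> continuous phi.
Proof. by move=> [dphi _] z; exact: differentiable_continuous. Qed.

Lemma cvg_cont_diff (E : normedModType R) (W : normedModType R) (phi : E -> W)
    (I : Type) (F : set_system I) (FF : Filter F) (w : I -> E) (z v : E) :
  cont_diff phi -> w @ F --> z -> (fun k => 'd phi (w k) v) @ F --> 'd phi z v.
Proof.
move=> [dphi cphi] wz; apply/cvgrPdistC_le => e e0.
have v0 : 0 < 1 + `|v| by rewrite ltr_wpDr.
have H : \forall k \near F, forall d,
    `|'d phi (w k) d - 'd phi z d| <= e / (1 + `|v|) * `|d|.
  exact: wz (cphi z (e / (1 + `|v|)) (divr_gt0 e0 v0)).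
apply: filterS H => k /(_ v) H; apply: le_trans H _.
by rewrite -mulrA ler_piMr ?(ltW e0) // ler_pdivrMl // mulr1 lerDr.
Qed.

End StrictDifferentiability.

Section Partials.
Context {R : realType} {n m : nat}.
Local Notation X := 'rV[R]_n.
Local Notation Y := 'rV[R]_m.

Lemma diff_partial_x (W : normedModType R) (phi : X * Y -> W) x y u :
  differentiable phi (x, y) ->
  differentiable (fun x' => phi (x', y)) x /\
  'd (fun x' => phi (x', y)) x u = 'd phi (x, y) (u, 0).
Proof.
move=> dphi; have dp : is_diff x (fun x' : X => (x', y)) (fun u => (u, 0)).
  by apply: is_diff_eq.
have dp1 := ex_diff; split; first exact: (differentiable_comp (g := phi)).
by rewrite (diff_comp (g := phi)) //= diff_val.
Qed.

Lemma diff_partial_y (W : normedModType R) (phi : X * Y -> W) x y v :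
  differentiable phi (x, y) ->
  differentiable (fun y' => phi (x, y')) y /\
  'd (fun y' => phi (x, y')) y v = 'd phi (x, y) (0, v).
Proof.
move=> dphi; have dp : is_diff y (fun y' : Y => (x, y')) (fun v => (0, v)).
  by apply: is_diff_eq.
split; first exact: (differentiable_comp (g := phi)).
by rewrite (diff_comp (g := phi)) //= diff_val.
Qed.

Lemma mul_Jx q (phi : X * Y -> 'rV[R]_q) x y u :
  differentiable phi (x, y) -> u *m Jx phi x y = 'd phi (x, y) (u, 0).
Proof. by move=> dphi; rewrite mul_rV_lin1; have [] := diff_partial_x u dphi. Qed.

Lemma mul_Jy q (phi : X * Y -> 'rV[R]_q) x y v :
  differentiable phi (x, y) -> v *m Jy phi x y = 'd phi (x, y) (0, v).
Proof. by move=> dphi; rewrite mul_rV_lin1; have [] := diff_partial_y v dphi. Qed.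

Lemma JxyE q (phi : X * Y -> 'rV[R]_q) x y u v :
  differentiable phi (x, y) -> Jxy phi x y u v = 'd phi (x, y) (u, v).
Proof.
move=> dphi; rewrite /Jxy mul_Jx // mul_Jy // -linearD.
by congr ('d phi _ _); apply: (f_equal2 pair); [exact: addr0|exact: add0r].
Qed.

Lemma dotv_grady (f : X * Y -> R) x y v :
  differentiable f (x, y) -> dotv (grady f x y) v = 'd f (x, y) (0, v).
Proof.
move=> df; have [_ <-] := diff_partial_y v df.
rewrite {2}[v]row_sum_delta linear_sum; apply: eq_bigr => j _.
by rewrite linearZ /= mxE mulrC.
Qed.

Variables (p1 p2 : nat) (h : X * Y -> 'rV[R]_p1) (g : X * Y -> 'rV[R]_p2).

Lemma diff_Pmap z v : differentiable h z -> differentiable g z ->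
  differentiable (Pmap h g) z /\
  'd (Pmap h g) z v = row_mx ('d h z v) ('d g z v).
Proof.
move=> dh dg.
have rl : linear (fun w : 'rV[R]_p1 * 'rV[R]_p2 => row_mx w.1 w.2).
  by move=> k a b; rewrite /= scale_row_mx add_row_mx.
pose rL : {linear ('rV[R]_p1 * 'rV[R]_p2)%type -> 'rV[R]_(p1 + p2)} :=
  HB.pack (fun w : 'rV[R]_p1 * 'rV[R]_p2 => row_mx w.1 w.2)
    (GRing.isLinear.Build _ _ _ _ _ rl).
have rc : continuous rL.
  move=> w; apply/cvgrPdist_le => e e0.
  have /cvgrPdist_le /(_ _ e0) := @cvg_id _ (nbhs w).
  apply: filterS => w'; rewrite /= opp_row_mx add_row_mx prod_normE ge_max.
  by move=> /andP[]; exact: norm_row_mx_le.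
have dr w : differentiable rL w by exact: linear_differentiable.
have dhg := differentiable_pair dh dg.
have -> : Pmap h g = rL \o (fun z => (h z, g z)) by [].
split; first exact: differentiable_comp.
have E := diff_comp (g := rL) dhg (dr _).
rewrite (diff_lin _ rc) (diff_pair dh dg) in E.
exact: (congr1 (fun k => k v) E).
Qed.

Lemma Pmap_cont_diff : cont_diff h -> cont_diff g -> cont_diff (Pmap h g).
Proof.
move=> [dh ch] [dg cg]; split=> [z|z e e0].
  by have [] := diff_Pmap 0 (dh z) (dg z).
apply: filterS2 (ch z e e0) (cg z e e0) => w H1 H2 v.
have -> : 'd (Pmap h g) w v - 'd (Pmap h g) z v =
    row_mx ('d h w v - 'd h z v) ('d g w v - 'd g z v).
  rewrite -add_row_mx -opp_row_mx; congr (_ - _).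
    exact: (diff_Pmap v (dh w) (dg w)).2.
  exact: (diff_Pmap v (dh z) (dg z)).2.
exact: norm_row_mx_le (H1 v) (H2 v).
Qed.

Lemma lagr_dxE (f : X * Y -> R) x y l u :
  differentiable f (x, y) -> differentiable (Pmap h g) (x, y) ->
  lagr_dx f h g x y l u = 'd f (x, y) (u, 0) + dotv l ('d (Pmap h g) (x, y) (u, 0)).
Proof.
move=> df dP; have [df1 dfE] := diff_partial_x u df.
have [dP1 dPE] := diff_partial_x u dP.
have ll : linear (dotv l) by move=> k a b; rewrite dotvDr dotvZr.
pose lL : {linear 'rV[R]_(p1 + p2) -> R} :=
  HB.pack (dotv l) (GRing.isLinear.Build _ _ _ _ _ ll).
have lc : continuous lL.
  by move=> w; apply: (@cvg_dotv R _ (nbhs w) _ _ (fun=> l) id); [exact: cvg_cst|exact: cvg_id].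
have dl w : differentiable lL w by exact: linear_differentiable.
have dlP : differentiable (lL \o (fun x' => Pmap h g (x', y))) x.
  exact: differentiable_comp.
rewrite /lagr_dx; have -> : (fun x' => lagr f h g x' y l) =
    (fun x' => f (x', y)) + (lL \o (fun x' => Pmap h g (x', y))).
  by apply/funext => x'; rewrite /lagr dotvC.
have E := diff_comp dP1 (dl _); rewrite (diff_lin _ lc) in E.
rewrite diffD //= dfE; congr (_ + _).
by rewrite -dPE; exact: (congr1 (fun k => k u) E).
Qed.

End Partials.

Section DifferenceQuotients.
Context {R : realType} {E : normedModType R} {I : Type} {F : set_system I}.
Context {FF : Filter F}.
Variables (a b : I -> E) (t : I -> R) (z w : E).
Hypotheses (az : a @ F --> z) (bz : b @ F --> z) (t0 : \forall k \near F, 0 < t k).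
Hypothesis abw : (fun k => (t k)^-1 *: (a k - b k)) @ F --> w.

(** The strict estimate is taken as a hypothesis so that one proof serves both scalar and row-valued
    maps. *)
Let quotient_cvg (W : normedModType R) (phi : E -> W) : cont_diff phi ->
  (forall e, 0 < e -> \forall k \near F,
    `|phi (a k) - phi (b k) - 'd phi z (a k - b k)| <= e * `|a k - b k|) ->
  (fun k => (t k)^-1 *: (phi (a k) - phi (b k))) @ F --> 'd phi z w.
Proof.
move=> [dphi _] strict.
have dw : (fun k => 'd phi z ((t k)^-1 *: (a k - b k))) @ F --> 'd phi z w.
  by apply: cvg_comp abw _; exact: diff_continuous.
apply/cvgrPdist_le => e e0.
have w0 : 0 < `|w| + 1 by rewrite ltr_wpDl.
(* [|w| + 1] eventually bounds the quotients of [a k - b k] by [t k], so the strict estimate with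
   this constant contributes at most [e / 2]. *)
have e1 : 0 < e / 2 / (`|w| + 1) by rewrite !divr_gt0.
move/cvgrPdist_le : dw => /(_ (e / 2) (divr_gt0 e0 (ltr0Sn _ 1))) H1.
have H2 : \forall k \near F, `|(t k)^-1 *: (a k - b k)| <= `|w| + 1.
  by apply: cvgr_norm_le abw _ _; rewrite ltrDl.
have H6 : \forall k \near F, `|(t k)^-1 *: (a k - b k)| <= `|w| + 1 /\ 0 < t k.
  by apply: filterS2 H2 t0.
apply: filterS3 (strict _ e1) H6 H1 => k H3 [H4 tk] H5.
rewrite -(subrK ('d phi z ((t k)^-1 *: (a k - b k))) ('d phi z w)) -addrA.
apply: le_trans (ler_normD _ _) _; rewrite [leRHS]splitr lerD //.
rewrite linearZ -scalerBr normrZ -normrN opprB gtr0_norm ?invr_gt0 //.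
apply: (@le_trans _ _ ((t k)^-1 * (e / 2 / (`|w| + 1) * `|a k - b k|))).
  by rewrite ler_pM2l ?invr_gt0.
have -> : (t k)^-1 * (e / 2 / (`|w| + 1) * `|a k - b k|) =
          e / 2 / (`|w| + 1) * `|(t k)^-1 *: (a k - b k)|.
  by rewrite normrZ gtr0_norm ?invr_gt0 // mulrCA.
by rewrite -[leRHS](divfK (lt0r_neq0 w0)) ler_pM2l.
Qed.

Lemma diff_quotient_cvg q (phi : E -> 'rV[R]_q) : cont_diff phi ->
  (fun k => (t k)^-1 *: (phi (a k) - phi (b k))) @ F --> 'd phi z w.
Proof.
move=> Cphi; apply: quotient_cvg => // e e0; exact: strict_diff.
Qed.

Lemma diff_quotient_cvg_real (phi : E -> R) : cont_diff phi ->
  (fun k => (t k)^-1 * (phi (a k) - phi (b k))) @ F --> 'd phi z w.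
Proof.
move=> Cphi; apply: quotient_cvg => // e e0; exact: strict_diff_real.
Qed.

End DifferenceQuotients.

Lemma cvg_max0 {R : realType} {I : Type} {F : set_system I} {FF : Filter F}
    (r : I -> R) (l : R) :
  r @ F --> l -> (fun k => Num.max 0 (r k)) @ F --> Num.max 0 l.
Proof.
have maxE (x : R) : Num.max 0 x = (x + `|x|) / 2.
  by case: (leP 0 x) => x0; [rewrite ger0_norm|rewrite ltr0_norm]; lra.
move=> rl; rewrite maxE; under eq_fun do rewrite maxE.
exact: cvgM (cvgD rl (cvg_norm rl)) (cvg_cst _).
Qed.

(** * Projection onto the constraint cone *)

Section Residual.
Context {R : realType} {q : nat}.
Variable e : 'I_q -> bool.

Definition sign_cone : set 'rV[R]_q :=
  [set z | forall i, if e i then z 0 i = 0 else z 0 i <= 0].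

(** The difference between [z] and its Euclidean projection onto [sign_cone], which acts
    coordinatewise; [residK] and [enorm_resid_le] show that its norm is the distance. *)
Definition resid (z : 'rV[R]_q) : 'rV[R]_q :=
  \row_i if e i then z 0 i else Num.max 0 (z 0 i).

Lemma residK z : sign_cone (z - resid z).
Proof.
move=> i; rewrite !mxE; case: (e i); first by rewrite subrr.
by rewrite subr_le0 le_max lexx orbT.
Qed.

Lemma resid_eq0 z : resid z = 0 -> sign_cone z.
Proof. by move=> z0; have := residK z; rewrite z0 subr0. Qed.

Lemma resid_sign_cone z : sign_cone z -> resid z = 0.
Proof.
move=> Cz; apply/rowP => i; rewrite !mxE; have := Cz i; case: (e i) => //.
by move=> ?; apply/max_idPl.
Qed.

Lemma resid_coord_le z c i : sign_cone c -> `|resid z 0 i| <= `|(z - c) 0 i|.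
Proof.
move=> Cc; have := Cc i; rewrite !mxE; case: (e i) => [->|c0]; first by rewrite subr0.
rewrite [`|Num.max _ _|]ger0_norm ?le_max ?lexx // ge_max normr_ge0 /=.
apply: le_trans (ler_norm _); lra.
Qed.

Lemma enorm_resid_le z c : sign_cone c -> enorm (resid z) <= enorm (z - c).
Proof.
move=> Cc; apply: ler_wsqrtr; apply: ler_sum => i _.
rewrite -!expr2 -real_normK ?num_real // -[leRHS]real_normK ?num_real //.
by rewrite lerXn2r ?nnegrE //; exact: resid_coord_le.
Qed.

(** After normalization and passage to the limit this becomes the complementarity condition of the
    multiplier. *)
Lemma dotv_resid_termwise z i : resid z 0 i * (z - resid z) 0 i = 0.
Proof.
rewrite !mxE; case: (e i); first by rewrite subrr mulr0.
by case: leP => _; rewrite ?mul0r // subrr mulr0.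
Qed.

Lemma resid_cvg (I : Type) (F : set_system I) (FF : Filter F)
    (a : I -> 'rV[R]_q) (z : 'rV[R]_q) :
  a @ F --> z -> (fun k => resid (a k)) @ F --> resid z.
Proof.
move=> az; apply: cvg_rV => i; have ai := cvg_coord (i := i) az.
rewrite mxE; under eq_fun do rewrite mxE.
by case: (e i) => //; exact: cvg_max0.
Qed.

(* sqrt is concave: this is the tangent inequality for the norm at z. *)
Lemma enormD_le (z x : 'rV[R]_q) : z <> 0 ->
  enorm (z + x) <= enorm z + (2 * dotv z x + dotv x x) / (2 * enorm z).
Proof.
move=> /enorm_gt0 z0; set s := enorm z in z0 *.
have h : dotv (z + x) (z + x) = s ^+ 2 + (2 * dotv z x + dotv x x).
  by rewrite enorm_sqr !dotvDl !dotvDr [dotv x z]dotvC; ring.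
set c := 2 * dotv z x + dotv x x in h *.
have hge : 0 <= s ^+ 2 + c by rewrite -h dotvv_ge0.
have r0 : 0 <= s + c / (2 * s).
  have -> : s + c / (2 * s) = (s ^+ 2 + c + s ^+ 2) / (2 * s).
    by field; rewrite lt0r_neq0.
  by rewrite divr_ge0 ?(addr_ge0 hge (sqr_ge0 s)) // mulr_ge0 // ltW.
rewrite -[leRHS]ger0_norm // -sqrtr_sqr; apply: ler_wsqrtr; rewrite h.
have -> : (s + c / (2 * s)) ^+ 2 = s ^+ 2 + c + (c / (2 * s)) ^+ 2.
  by field; rewrite lt0r_neq0.
by rewrite lerDl sqr_ge0.
Qed.

End Residual.

Section Ekeland.
Context {R : realType} {m : nat}.

(** Minimize [psi y + eta * |y - y0|]: outside the ball [B] the penalty alone exceeds [psi y0], so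
    compactness of [B] yields a global minimizer, and the triangle inequality recentres the penalty
    at it. *)
Lemma ekeland_rV (psi : 'rV[R]_m -> R) (y0 : 'rV[R]_m) (eta : R) :
  continuous psi -> (forall y, 0 <= psi y) -> 0 < eta ->
  exists y1, eta * `|y1 - y0| <= psi y0 /\
    forall y, psi y1 <= psi y + eta * `|y - y1|.
Proof.
move=> cpsi psi0 eta0; pose phi y := psi y + eta * `|y - y0|.
have cdist : continuous (fun y : 'rV[R]_m => `|y - y0|).
  move=> y; apply: (@cvg_norm _ _ _ (nbhs y) _ (fun y => y - y0)).
  by apply: (@cvgB _ _ _ (nbhs y)); [exact: cvg_id|exact: cvg_cst].
have cphi : continuous phi.
  move=> y; exact: cvgD (cpsi y) (cvgM (cvg_cst eta) (cdist y)).
pose B := [set y | `|y - y0| <= psi y0 / eta].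
have By0 : B y0 by rewrite /B /= subrr normr0 divr_ge0 // ltW.
have cB : compact B.
  apply: bounded_closed_compact.
    exists (psi y0 / eta + `|y0|); split; first exact: num_real.
    move=> M ltM y By /=; rewrite -(subrK y0 y).
    by apply: le_trans (ler_normD _ _) (le_trans _ (ltW ltM)); rewrite lerD2r.
  apply: (@closed_comp _ _ (fun y : 'rV[R]_m => `|y - y0|) [set x : R | x <= psi y0 / eta]).
    by move=> y _; exact: cdist.
  exact: closed_le.
have [y1 By1 miny1] := EVT_min_rV (ex_intro _ y0 By0) cB (continuous_subspaceT cphi).
have phi10 : phi y1 <= psi y0.
  have := miny1 y0; rewrite inE => /(_ By0).
  by rewrite {2}/phi subrr normr0 mulr0 addr0.
exists y1; split.
  by apply: le_trans phi10; rewrite /phi lerDr.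
move=> y; have phi1y : phi y1 <= phi y.
  have [By|nBy] := pselect (B y); first by apply: miny1; rewrite inE.
  apply: le_trans phi10 _; move/negP: nBy; rewrite -ltNge ltr_pdivrMr // mulrC.
  by move=> /ltW /le_trans; apply; rewrite /phi lerDr.
have tri : `|y - y0| <= `|y - y1| + `|y1 - y0|.
  by rewrite -(subrKA y1) ler_normD.
move: phi1y; rewrite /phi => phi1y.
have : eta * `|y - y0| <= eta * `|y - y1| + eta * `|y1 - y0|.
  by rewrite -mulrDr ler_pM2l.
lra.
Qed.

End Ekeland.

(** * Cones, multipliers and duality for the program *)

Definition eq_index {p1 p2 : nat} (i : 'I_(p1 + p2)) : bool := (i < p1)%N.

Section ProgramCones.
Context {R : realType} {n m p1 p2 : nat}.
Local Notation X := 'rV[R]_n.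
Local Notation Y := 'rV[R]_m.
Local Notation Q := 'rV[R]_(p1 + p2).
Local Notation isEq := (@eq_index p1 p2).

Lemma eq_index_lshift (i : 'I_p1) : isEq (lshift p2 i).
Proof. by rewrite /eq_index /= ltn_ord. Qed.

Lemma eq_index_rshift (i : 'I_p2) : isEq (rshift p1 i) = false.
Proof. by rewrite /eq_index /= ltnNge leq_addr. Qed.

Lemma CsetE : @Cset R p1 p2 = sign_cone isEq.
Proof.
apply/seteqP; split=> z.
  move=> [z0 zle] i; case: (split_ordP i) => j ->.
    rewrite eq_index_lshift; have := congr1 (fun w : 'rV_p1 => w 0 j) z0.
    by rewrite !mxE.
  by rewrite eq_index_rshift; have := zle j; rewrite mxE.
move=> Cz; split=> [|j].
  by apply/rowP => j; rewrite !mxE; have := Cz (lshift p2 j); rewrite eq_index_lshift.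
by rewrite mxE; have := Cz (rshift p1 j); rewrite eq_index_rshift.
Qed.

Lemma edistv_Cset (z : Q) : edistv z (@Cset R p1 p2) = (enorm (resid isEq z))%:E.
Proof.
rewrite CsetE; apply/eqP; rewrite eq_le; apply/andP; split.
  apply: ereal_inf_lbound; exists (z - resid isEq z); first exact: residK.
  by rewrite opprB addrC subrK.
by apply: le_ereal_inf_tmp => _ [c Cc <-]; rewrite lee_fin; exact: enorm_resid_le.
Qed.

Lemma normal_coneE (z l : Q) : @Cset R p1 p2 z ->
  normal_cone (@Cset R p1 p2) z l <-> polar_cone isEq z l.
Proof.
rewrite CsetE => Cz; split=> [[_ nl] i|lz].
  case ei : (isEq i); [by left|right].
  have zi : z 0 i <= 0 by have := Cz i; rewrite ei.
  (* Perturbing coordinate [i] alone: [s = -1] gives the sign of [l 0 i], and [s = - z 0 i] the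
     complementarity. *)
  have test s : z 0 i + s <= 0 -> l 0 i * s <= 0.
    move=> zs; have := nl (z + s *: delta_mx 0 i).
    rewrite addrAC subrr add0r dotvZr dotv_delta mulrC; apply => j.
    have [->|ji] := eqVneq j i; first by rewrite ei !mxE !eqxx mulr1.
    have := Cz j; rewrite !mxE eqxx (negbTE ji) mulr0 addr0; exact.
  have l0 : 0 <= l 0 i.
    by have := test (- 1); rewrite mulrN1 oppr_le0; apply; lra.
  split=> //; apply/eqP; rewrite eq_le mulr_ge0_le0 //=.
  by have := test (- z 0 i); rewrite subrr mulrN oppr_le0; apply.
split=> // a Ca; apply: sumr_le0 => i _; rewrite !mxE.
have := Ca i; have := Cz i; case: ifP => [_ -> ->|ei z0 a0]; first by rewrite subrr mulr0.
case: (lz i) => [|[l0 lz0]]; first by rewrite ei.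
by rewrite mulrBr lz0 subr0 mulr_ge0_le0.
Qed.

Variables (f : X * Y -> R) (h : X * Y -> 'rV[R]_p1) (g : X * Y -> 'rV[R]_p2).
Hypotheses (f_C1 : cont_diff f) (h_C1 : cont_diff h) (g_C1 : cont_diff g).
Local Notation P := (Pmap h g).

Let P_C1 : cont_diff P := Pmap_cont_diff h_C1 g_C1.

Lemma dPmap_y x y v :
  'd P (x, y) (0, v) = row_mx (v *m Jy h x y) (v *m Jy g x y).
Proof.
rewrite (mul_Jy _ (h_C1.1 (x, y))) (mul_Jy _ (g_C1.1 (x, y))).
exact: (diff_Pmap _ (h_C1.1 _) (g_C1.1 _)).2.
Qed.

Lemma dPmap_Jxy x y u v :
  'd P (x, y) (u, v) = row_mx (Jxy h x y u v) (Jxy g x y u v).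
Proof.
rewrite (JxyE _ _ (h_C1.1 (x, y))) (JxyE _ _ (g_C1.1 (x, y))).
exact: (diff_Pmap _ (h_C1.1 _) (g_C1.1 _)).2.
Qed.

Lemma dsplit (W : normedModType R) (phi : X * Y -> W) z u v :
  'd phi z (u, v) = 'd phi z (u, 0) + 'd phi z (0, v).
Proof.
rewrite -linearD; congr ('d phi _ _).
by apply: (f_equal2 pair); [exact/esym/addr0|exact/esym/add0r].
Qed.

Lemma lin_feasibleP x y d v :
  lin_feasible h g x y d v <->
  tangent_cone isEq (P (x, y)) (d + 'd P (x, y) (0, v)).
Proof.
rewrite dPmap_y; split=> [[Hh Hg] i|T].
  case: (split_ordP i) => j ->.
    rewrite eq_index_lshift mxE row_mxEl.
    by have := congr1 (fun w : 'rV_p1 => w 0 j) Hh; rewrite !mxE.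
  rewrite eq_index_rshift row_mxEr => /Hg.
  by rewrite [(rsubmx d + _) 0 j]mxE [rsubmx d 0 j]mxE [(d + _) 0 _]mxE row_mxEr.
split=> [|j gj].
  apply/rowP => j; have := T (lshift p2 j); rewrite eq_index_lshift mxE row_mxEl.
  by move=> H0; rewrite [RHS]mxE -H0 [LHS]mxE [lsubmx d 0 j]mxE.
have := T (rshift p1 j); rewrite eq_index_rshift row_mxEr => /(_ gj).
by rewrite [(rsubmx d + _) 0 j]mxE [rsubmx d 0 j]mxE [(d + _) 0 _]mxE row_mxEr.
Qed.

Lemma orth_Jy x y l :
  (forall v, dotv l ('d P (x, y) (0, v)) = 0) <-> l *m (Jy P x y)^T = 0.
Proof.
split=> [H|H v].
  apply: dotv_eq0 => v; rewrite dotvC -dotv_mulmx dotvC (mul_Jy _ (P_C1.1 _)).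
  exact: H.
by rewrite -(mul_Jy _ (P_C1.1 _)) dotvC dotv_mulmx H dotv0r.
Qed.

Lemma polar_singular x y l :
  polar_cone isEq (P (x, y)) l -> (forall v, dotv l ('d P (x, y) (0, v)) = 0) ->
  singular_multiplier h g x y (lsubmx l) (rsubmx l).
Proof.
move=> pl ol; split.
- apply: dotv_eq0 => v; rewrite dotvC dotvDr -!dotv_mulmx -(ol v) dPmap_y.
  by rewrite -{3}[l]hsubmxK dotv_row_mx ![dotv _ (_ *m _)]dotvC.
- by move=> j; rewrite mxE; case: (pl (rshift p1 j)) => [|[//]]; rewrite eq_index_rshift.
- apply: big1 => j _; rewrite mxE; case: (pl (rshift p1 j)) => [|[_]].
    by rewrite eq_index_rshift.
  by rewrite row_mxEr.
Qed.

Lemma multipliersP x y l : feas h g x y ->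
  multipliers f h g x y l <->
  polar_cone isEq (P (x, y)) l /\
  (forall v, 'd f (x, y) (0, v) + dotv l ('d P (x, y) (0, v)) = 0).
Proof.
move=> Fy; have E v : dotv (grady f x y + l *m (Jy P x y)^T) v =
    'd f (x, y) (0, v) + dotv l ('d P (x, y) (0, v)).
  rewrite dotvDl (dotv_grady _ (f_C1.1 _)) [dotv (l *m _) v]dotvC -dotv_mulmx.
  by rewrite (mul_Jy _ (P_C1.1 _)) [dotv l _]dotvC.
split=> [[/(normal_coneE _ Fy) pl H]|[pl H]].
  by split=> // v; rewrite -E H dotv0l.
split; first exact/(normal_coneE _ Fy).
by apply: dotv_eq0 => v; rewrite E H.
Qed.

(** In order: a linearized direction of cost at most [c], a singular multiplier certifying that no
    linearized direction exists, or a Lagrange multiplier certifying that the linearized optimum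
    exceeds [c]. It is applied with [q] equal to 0 or to the derivative of [P] in the direction [u]
    or [- u]. *)
Lemma program_farkas x y (q : Q) (c : R) : feas h g x y ->
  (exists2 v, tangent_cone isEq (P (x, y)) (q + 'd P (x, y) (0, v)) &
              'd f (x, y) (0, v) <= c) \/
  (exists l, [/\ polar_cone isEq (P (x, y)) l,
                 (forall v, dotv l ('d P (x, y) (0, v)) = 0) & 0 < dotv l q]) \/
  (exists2 l, multipliers f h g x y l & c < dotv l q).
Proof.
move=> Fy.
case: (farkas_tangent isEq (P (x, y)) q (Jy P x y) (grady f x y) c).
- case=> v Tv gv; left; exists v.
    by rewrite -(mul_Jy _ (P_C1.1 _)).
  by rewrite -(dotv_grady _ (f_C1.1 _)).
- case=> -[l [pl ol lq]]; right; [left|right].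
    by exists l; split=> //; apply/orth_Jy.
  by exists l => //; split=> //; apply/normal_coneE.
Qed.

(** Singular multipliers are recession directions of the multiplier set. *)
Lemma multipliersD x y l l' : feas h g x y -> multipliers f h g x y l ->
  polar_cone isEq (P (x, y)) l' -> (forall v, dotv l' ('d P (x, y) (0, v)) = 0) ->
  multipliers f h g x y (l + l').
Proof.
move=> Fy /(multipliersP _ Fy) [pl H] pl' H'; apply/(multipliersP _ Fy).
by split=> [|v]; [exact: polarD|rewrite dotvDl addrA H H' addr0].
Qed.

End ProgramCones.

(** * Directional neighbourhoods and the image directional derivative *)

Section DirectionalNeighbourhoods.
Context {R : realType} {n : nat}.
Implicit Types u dx : 'rV[R]_n.

Lemma dir_nbhd0 (e delta : R) u : 0 < e -> dir_nbhd e delta u 0.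
Proof. by move=> e0; split=> //; rewrite enorm0. Qed.

Lemma dir_nbhd_mono (e e' delta delta' : R) u dx :
  e <= e' -> delta <= delta' -> dir_nbhd e delta u dx -> dir_nbhd e' delta' u dx.
Proof.
move=> ee dd [h1 h2]; split=> [|u0 z0]; first exact: lt_le_trans h1 ee.
exact: le_trans (h2 u0 z0) dd.
Qed.

(* For u = 0 every small vector is t us with t the square root of its norm. *)
Lemma dir_nbhd_split u (r : R) : 0 < r ->
  exists2 e, 0 < e & forall dx, dir_nbhd e e u dx -> dx <> 0 ->
    exists t us, [/\ 0 < t < r, `|us - u| < r & dx = t *: us].
Proof.
move=> r0; have [->|/eqP u0] := eqVneq u 0.
  exists (r ^+ 2); first exact: exprn_gt0.
  move=> dx [ltr _] /enorm_gt0 dx0; pose t := Num.sqrt (enorm dx).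
  have t0 : 0 < t by rewrite sqrtr_gt0.
  have tr : t < r.
    by rewrite -(ltr_pXn2r (ltn0Sn 1)) ?nnegrE ?ltW // sqr_sqrtr // ltW.
  exists t, (t^-1 *: dx); split; rewrite ?t0 ?tr ?scalerA ?divff ?scale1r ?lt0r_neq0 //.
  rewrite subr0 normrZ gtr0_norm ?invr_gt0 //; apply: le_lt_trans tr.
  rewrite ler_pdivrMl //; apply: le_trans (norm_le_enorm _) _.
  by rewrite -expr2 sqr_sqrtr // ltW.
have su := enorm_gt0 u0; set s := enorm u in su.
(* With [t] the quotient of the norms of [dx] and [u], the first bound gives [t < r]. The second,
   multiplied by [s], makes the angular deviation at most [r / 2]. *)
have e0 : 0 < Num.min (r * s) (r / (2 * s)).
  by rewrite lt_min mulr_gt0 // divr_gt0 // mulr_gt0.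
exists (Num.min (r * s) (r / (2 * s))) => // dx [lt_e ang] dxn0.
have sd := enorm_gt0 dxn0; set sdx := enorm dx in sd lt_e.
have t0 : 0 < sdx / s by rewrite divr_gt0.
exists (sdx / s), ((sdx / s)^-1 *: dx); split.
- by rewrite t0 /= ltr_pdivrMr // (lt_le_trans lt_e) // ge_min lexx.
- have -> : (sdx / s)^-1 *: dx - u = s *: (sdx^-1 *: dx - s^-1 *: u).
    by rewrite scalerBr !scalerA divff ?lt0r_neq0 // scale1r invf_div.
  rewrite normrZ gtr0_norm // -ltr_pdivlMl //.
  apply: le_lt_trans (norm_le_enorm _) _; apply: le_lt_trans (ang u0 dxn0) _.
  apply: (@le_lt_trans _ _ (r / (2 * s))); first by rewrite ge_min lexx orbT.
  rewrite invfM mulrA mulrC ltr_pM2l ?invr_gt0 //.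
  by rewrite ltr_pdivrMr // ltr_pMr // ltr1n.
- by rewrite scalerA divff ?scale1r // lt0r_neq0.
Qed.

Lemma near_dir_nbhd u (e delta : R) (I : Type) (F : set_system I) (FF : Filter F)
    (t : I -> R) (us : I -> 'rV[R]_n) :
  0 < e -> 0 < delta -> t @ F --> 0 -> (\forall k \near F, 0 < t k) ->
  us @ F --> u -> \forall k \near F, dir_nbhd e delta u (t k *: us k).
Proof.
move=> e0 d0 t0 tp usu.
have tu : (fun k => t k *: us k) @ F --> (0 : 'rV[R]_n).
  by rewrite -(scale0r u); exact: cvgZ.
have H1 : \forall k \near F, enorm (t k *: us k) < e.
  apply: cvgr_lt _ e0; rewrite -(enorm0 n); exact: cvg_enorm.
have [->|/eqP u0] := eqVneq u 0.
  by apply: filterS H1 => k H; split.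
have su := enorm_gt0 u0.
have Hn : (fun k => (enorm (us k))^-1 *: us k) @ F --> (enorm u)^-1 *: u.
  by apply: cvgZ => //; apply: cvgV; [exact: lt0r_neq0|exact: cvg_enorm].
have H2 : \forall k \near F,
    enorm ((enorm (us k))^-1 *: us k - (enorm u)^-1 *: u) <= delta.
  have Hd : (fun k => (enorm (us k))^-1 *: us k - (enorm u)^-1 *: u) @ F -->
            (0 : 'rV[R]_n).
    by rewrite -(subrr ((enorm u)^-1 *: u)); apply: cvgB Hn (cvg_cst _).
  apply: cvgr_le _ d0; rewrite -(enorm0 n); exact: cvg_enorm.
apply: filterS3 H1 H2 tp => k h1 h2 h3; split=> // _ z0.
rewrite enormZ gtr0_norm // invfM scalerA mulrAC mulVf ?mul1r // lt0r_neq0 //.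
Qed.

End DirectionalNeighbourhoods.

Section ImageDerivative.
Context {R : realType} {n m q : nat}.
Variables (P : 'rV[R]_n * 'rV[R]_m -> 'rV[R]_q).

Lemma harmonic_small (r : R) : 0 < r -> exists k, forall j, (k <= j)%N -> (j.+1%:R)^-1 < r.
Proof.
move=> r0; have /cvgrPdist_lt /(_ r r0) [k _ H] := @cvg_harmonic R.
exists k => j /H; rewrite /= sub0r normrN gtr0_norm ?invr_gt0 //.
Qed.

Lemma cvg_harmonic_le (V : normedModType R) (a : nat -> V) (l : V) :
  (forall k, `|a k - l| <= (k.+1%:R)^-1) -> a @ \oo --> l.
Proof.
move=> al; apply/cvgrPdistC_le => e e0; have [k Hk] := harmonic_small e0.
by exists k => // j /= /Hk /ltW; apply: le_trans.
Qed.

(** Directions below are found as limits along ultrafilters, whereas [ImDx] asks for sequences; this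
    form needs a single point for each tolerance. *)
Lemma ImDx_eps x y u (a : R) (w : 'rV[R]_q) : 0 <= a ->
  (forall r, 0 < r -> exists t us, let b := P (x + t *: us, y) - P (x, y) in
     [/\ 0 < t < r, `|us - u| < r, b <> 0 & `|(enorm b)^-1 *: b - w| < r]) ->
  ImDx P x y u (a *: w).
Proof.
move=> a0 H; right; exists a, w.
have /choice [ts Hts] : forall k : nat, exists ts : R * 'rV[R]_n,
    let b := P (x + ts.1 *: ts.2, y) - P (x, y) in
    [/\ 0 < ts.1 < (k.+1%:R)^-1, `|ts.2 - u| < (k.+1%:R)^-1, b <> 0 &
        `|(enorm b)^-1 *: b - w| < (k.+1%:R)^-1].
  move=> k; have [|t [us Htu]] := H (k.+1%:R)^-1; first by rewrite invr_gt0.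
  by exists (t, us).
exists (fun k => (ts k).1), (fun k => (ts k).2); split=> //.
- split=> [k|]; first by have [/andP[]] := Hts k.
  apply: cvg_harmonic_le => k; have [/andP[t0 tk] _ _ _] := Hts k.
  by rewrite subr0 gtr0_norm // ltW.
- by apply: cvg_harmonic_le => k; have [_ /ltW] := Hts k.
- by move=> k; have [] := Hts k.
- by apply: cvg_harmonic_le => k; have [_ _ _ /ltW] := Hts k.
Qed.

(** The scale [tau] may be any positive one: normalizing the increments cancels it, and the norm of
    [d] supplies the factor [a] in the definition of [ImDx]. *)
Lemma ImDx_limit x y u (U : set_system nat) (UU : ProperFilter U)
    (dx : nat -> 'rV[R]_n) (tau : nat -> R) d :
  (forall r, 0 < r -> \forall k \near U, dir_nbhd r r u (dx k)) ->
  (forall k, 0 < tau k) ->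
  (fun k => (tau k)^-1 *: (P (x + dx k, y) - P (x, y))) @ U --> d ->
  ImDx P x y u d.
Proof.
move=> Udx tau0 Ud; have [->|/eqP d0] := eqVneq d 0; first by left.
have sd := enorm_gt0 d0; have sd' := lt0r_neq0 sd.
have -> : d = enorm d *: ((enorm d)^-1 *: d) by rewrite scalerA divff // scale1r.
apply: ImDx_eps => [|r r0]; first exact: ltW.
pose b k := P (x + dx k, y) - P (x, y).
have dirE k : (enorm ((tau k)^-1 *: b k))^-1 *: ((tau k)^-1 *: b k) =
              (enorm (b k))^-1 *: b k.
  rewrite enormZ gtr0_norm ?invr_gt0 // invfM scalerA invrK mulrAC divff.
    by rewrite mul1r.
  exact: lt0r_neq0.
have Hdir : (fun k => (enorm (b k))^-1 *: b k) @ U --> (enorm d)^-1 *: d.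
  under eq_fun do rewrite -dirE.
  by apply: cvgZ => //; apply: cvgV => //; exact: cvg_enorm.
(* Here [d <> 0] yields the nonvanishing increments that [ImDx] demands, and with them
   [dx k <> 0]. *)
have Hb : \forall k \near U, b k <> 0.
  have He : (fun k => enorm ((tau k)^-1 *: b k)) @ U --> enorm d by exact: cvg_enorm.
  have : \forall k \near U, enorm d / 2 < enorm ((tau k)^-1 *: b k).
    by apply: cvgr_gt He _ _; lra.
  by apply: filterS => k H bk; move: H; rewrite bk scaler0 enorm0; lra.
have [e e0 He] := dir_nbhd_split u r0.
move/cvgrPdistC_lt : Hdir => /(_ r r0) Hdir.
have [k [Hk1 [Hk2 Hk3]]] : exists k, dir_nbhd e e u (dx k) /\ (b k <> 0 /\
    `|(enorm (b k))^-1 *: b k - (enorm d)^-1 *: d| < r).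
  apply: (@filter_ex _ U); apply: filterS3 (Udx e e0) Hb Hdir => k; by [].
have [|t [us [tr usr Edx]]] := He _ Hk1.
  by move=> dx0; apply: Hk2; rewrite /b dx0 addr0 subrr.
by exists t, us; rewrite -Edx.
Qed.

End ImageDerivative.

Lemma cvg_pair_normed {R : realType} {I : Type} {F : set_system I} {FF : Filter F}
    (E1 E2 : normedModType R) (a : I -> E1) (b : I -> E2) (la : E1) (lb : E2) :
  a @ F --> la -> b @ F --> lb -> (fun k => (a k, b k)) @ F --> (la, lb).
Proof.
move=> al bl; apply/cvgrPdist_le => e e0.
move/cvgrPdist_le : al => /(_ e e0) al; move/cvgrPdist_le : bl => /(_ e e0) bl.
by apply: filterS2 al bl => k ak bk; rewrite prod_normE ge_max ak.
Qed.

Lemma ler_cvg {R : realType} {I : Type} {F : set_system I} {FF : ProperFilter F}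
    (a b : I -> R) (la lb : R) :
  a @ F --> la -> b @ F --> lb -> (\forall k \near F, a k <= b k) -> la <= lb.
Proof.
move=> al bl ab; rewrite leNgt; apply/negP => lt_ba.
have H1 : \forall k \near F, (la + lb) / 2 < a k by apply: (cvgr_gt _ al); lra.
have H2 : \forall k \near F, b k < (la + lb) / 2 by apply: (cvgr_lt _ bl); lra.
have [k] : exists k, [/\ (la + lb) / 2 < a k, b k < (la + lb) / 2 & a k <= b k].
  by apply: (@filter_ex _ F); apply: filterS3 H1 H2 ab.
by case; lra.
Qed.

(** * Robinson stability *)

Section RobinsonStability.
Context {R : realType} {n m p1 p2 : nat}.
Local Notation X := 'rV[R]_n.
Local Notation Y := 'rV[R]_m.
Local Notation Q := 'rV[R]_(p1 + p2).
Local Notation isEq := (@eq_index p1 p2).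
Variables (h : X * Y -> 'rV[R]_p1) (g : X * Y -> 'rV[R]_p2).
Hypotheses (h_C1 : cont_diff h) (g_C1 : cont_diff g).
Local Notation P := (Pmap h g).
Local Notation res z := (resid isEq (Pmap h g z)).

Let P_C1 : cont_diff P := Pmap_cont_diff h_C1 g_C1.

Lemma continuous_enorm_resid : continuous (fun z => enorm (res z)).
Proof.
move=> z; apply: cvg_enorm; apply: resid_cvg.
exact: (cont_diff_continuous P_C1).
Qed.

Lemma resid_feas x y : (res (x, y) = 0) <-> feas h g x y.
Proof.
rewrite /feas /= CsetE; split; [exact: resid_eq0|exact: resid_sign_cone].
Qed.

(* The distance to C has the normalized residual as gradient outside C. *)
Lemma infeas_stationary x y1 (eta : R) (v : Y) : res (x, y1) <> 0 ->
  (forall y, enorm (res (x, y1)) <= enorm (res (x, y)) + eta * `|y - y1|) ->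
  - eta * `|v| * enorm (res (x, y1)) <= dotv (res (x, y1)) ('d P (x, y1) (0, v)).
Proof.
move=> zn0 slope; set z := res (x, y1); have s0 := enorm_gt0 zn0; rewrite -/z in s0.
set s := enorm z in s0 *.
pose F : set_system R := (0 : R)^'+.
have FF : ProperFilter F by exact: at_right_proper_filter.
have t0 : (fun t : R => t) @ F --> (0 : R) by exact: cvg_at_right_filter.
have tp : \forall t \near F, 0 < t by exact: nbhs_right_gt.
pose xi t := P (x, y1 + t *: v) - P (x, y1).
have at0 : (fun t : R => (x, y1 + t *: v)) @ F --> (x, y1).
  apply: cvg_pair_normed; first exact: cvg_cst.
  rewrite -[X in _ --> X]addr0 -(scale0r v).
  by apply: cvgD; [exact: cvg_cst|apply: cvgZ => //; exact: cvg_cst].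
have Hq : (fun t => t^-1 *: xi t) @ F --> 'd P (x, y1) (0, v).
  apply: diff_quotient_cvg => //; first exact: cvg_cst.
  apply: (@cvg_trans _ ((fun=> (0, v)) @ F)); last exact: cvg_cst.
  apply: near_eq_cvg; near=> t.
  have tpos : 0 < t by near: t.
  apply: (f_equal2 pair); first by rewrite /= subrr scaler0.
  by rewrite /= addrAC subrr add0r scalerA mulVf ?scale1r // lt0r_neq0.
have Hxi : xi @ F --> (0 : Q).
  rewrite -(subrr (P (x, y1))); apply: cvgB; last exact: cvg_cst.
  by apply: cvg_comp at0 _; exact: (cont_diff_continuous P_C1).
have key : \forall t \near F, - eta * `|v| * s <=
    dotv z (t^-1 *: xi t) + dotv (xi t) (t^-1 *: xi t) / 2.
  apply: filterS tp => t tpos.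
  (* [P (x, y1) - z] is a point of C. Measuring the distance to this fixed point majorizes the
     distance to C by a function smooth near [t = 0], with equality at [t = 0]. *)
  have h1 : enorm (res (x, y1 + t *: v)) <= enorm (z + xi t).
    have -> : z + xi t = P (x, y1 + t *: v) - (P (x, y1) - z).
      by rewrite /xi opprB addrCA.
    by apply: enorm_resid_le; exact: residK.
  have h2 := slope (y1 + t *: v).
  rewrite addrAC subrr add0r normrZ gtr0_norm // -/z -/s in h2.
  have h3 := enormD_le (xi t) zn0; rewrite -/z -/s in h3.
  have : 0 <= (2 * dotv z (xi t) + dotv (xi t) (xi t)) / (2 * s) + eta * (t * `|v|).
    by lra.
  rewrite !dotvZr -(pmulr_rge0 _ s0) -(@pmulr_rge0 _ t^-1) ?invr_gt0 // => H.
  rewrite -subr_ge0; apply: le_trans H _; rewrite le_eqVlt; apply/orP; left.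
  by apply/eqP; field; rewrite !lt0r_neq0.
have lim1 : (fun t => dotv z (t^-1 *: xi t) + dotv (xi t) (t^-1 *: xi t) / 2) @ F -->
    dotv z ('d P (x, y1) (0, v)) + dotv (0 : Q) ('d P (x, y1) (0, v)) / 2.
  apply: cvgD; first by apply: cvg_dotv => //; exact: cvg_cst.
  by apply: cvgM; [exact: cvg_dotv|exact: cvg_cst].
rewrite dotv0l mul0r addr0 in lim1.
by apply: ler_cvg (cvg_cst _) lim1 key.
Unshelve. all: by end_near. Qed.

(** The Ekeland point stays infeasible because it lies closer to [y0] than the feasible set does;
    the factor [m%:R] converts the max norm into the Euclidean one. *)
Lemma infeas_ekeland x y0 (eta : R) : 0 < eta ->
  ((m%:R * (enorm (res (x, y0)) / eta))%:E < edistv y0 (feas h g x))%E ->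
  exists y1, [/\ eta * `|y1 - y0| <= enorm (res (x, y0)), res (x, y1) <> 0 &
    forall v, - eta * `|v| * enorm (res (x, y1)) <=
              dotv (res (x, y1)) ('d P (x, y1) (0, v))].
Proof.
move=> eta0 far.
have cpsi : continuous (fun y => enorm (res (x, y))).
  move=> y; have pairy : (fun y => (x, y)) @ nbhs y --> (x, y).
    by apply: cvg_pair_normed; [exact: cvg_cst|exact: cvg_id].
  have Hp : (fun y => P (x, y)) @ nbhs y --> P (x, y).
    by apply: cvg_comp pairy _; exact: (cont_diff_continuous P_C1).
  exact: (@cvg_enorm R _ (nbhs y) _ _ _ _ (@resid_cvg _ _ isEq _ (nbhs y) _ _ _ Hp)).
have [y1 [H1 H2]] := ekeland_rV y0 cpsi (fun y => enorm_ge0 _) eta0.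
have zn0 : res (x, y1) <> 0.
  move=> /resid_feas Fy1; move: far; apply/negP; rewrite -leNgt.
  apply: (@le_trans _ _ (enorm (y0 - y1))%:E).
    by apply: ereal_inf_lbound; exists y1.
  rewrite lee_fin; apply: le_trans (enorm_le_norm _) _.
  by rewrite ler_wpM2l // ler_pdivlMr // distrC mulrC.
by exists y1; split=> // v; exact: infeas_stationary.
Qed.

Lemma not_robinson_approx xb y u : feas h g xb y -> ~ robinson_stable h g xb y u ->
  forall e : R, 0 < e -> exists dx y1, [/\ dir_nbhd e e u dx, `|y1 - y| <= e,
    res (xb + dx, y1) <> 0 &
    forall v, - e * `|v| * enorm (res (xb + dx, y1)) <=
              dotv (res (xb + dx, y1)) ('d P (xb + dx, y1) (0, v))].
Proof.
move=> Fy nRS e e0.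
(* Ekeland's point moves by at most the residual divided by the slope [e], hence by [e / 2]; the
   other half of [e] is left for [dy]. *)
have e20 : 0 < e ^+ 2 / 2 by rewrite divr_gt0 // exprn_gt0.
have res0 : res (xb, y) = 0 by apply/resid_feas.
have : \forall z \near (xb, y), enorm (res z) < e ^+ 2 / 2.
  have H : (fun z => enorm (res z)) @ nbhs (xb, y) --> (0 : R).
    by rewrite -(enorm0 (p1 + p2)) -res0; exact: continuous_enorm_resid.
  exact: (cvgr_lt _ H).
move=> /nbhs_ballP [r /= r0 Hr].
pose d := Num.min e (Num.min (e / 2) r).
have d0 : 0 < d by rewrite !lt_min e0 r0 divr_gt0.
have de : d <= e by rewrite ge_min lexx.
have de2 : d <= e / 2 by rewrite !ge_min lexx orbT.
have dr : d <= r by rewrite !ge_min lexx !orbT.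
apply: contrapT => Hno; apply: nRS; split=> //.
(* Failure of the estimate with this modulus is the hypothesis of [infeas_ekeland] for the slope
   [e]. *)
exists (m%:R / e), d, d; split=> //; first by rewrite divr_ge0 // ltW.
move=> dx dy Hdx Hdy; rewrite edistv_Cset -EFinM leNgt; apply/negP => far.
have [|y1 [H1 H2 H3]] := infeas_ekeland (x := xb + dx) (y0 := y + dy) e0.
  by move: far; rewrite mulrAC -mulrA.
apply: Hno; exists dx, y1; split=> //; first exact: dir_nbhd_mono Hdx.
have small : enorm (res (xb + dx, y + dy)) < e ^+ 2 / 2.
  apply: Hr; split; rewrite -ball_normE /ball_ /= opprD addrA subrr sub0r normrN.
    by apply: le_lt_trans (norm_le_enorm _) _; apply: lt_le_trans dr; case: Hdx.
  by apply: le_lt_trans (norm_le_enorm _) _; exact: lt_le_trans Hdy dr.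
have : `|y1 - (y + dy)| <= e / 2.
  rewrite -(ler_pM2l e0); apply: le_trans H1 _; apply: le_trans (ltW small) _.
  by rewrite expr2 mulrA.
have : `|dy| <= e / 2.
  by apply: le_trans (norm_le_enorm _) _; apply: le_trans (ltW Hdy) de2.
have : `|y1 - y| <= `|y1 - (y + dy)| + `|dy|.
  by apply: le_trans (ler_normD _ _); rewrite opprD addrA subrK.
lra.
Qed.

End RobinsonStability.

(** The variational inequality of the projection, one coordinate at a time. It yields both the sign
    of [l 0 i * w 0 i] and the vanishing of the rescaled residuals. *)
Lemma resid_sqr_le {R : realType} {q : nat} (e : 'I_q -> bool) (z c : 'rV[R]_q) i :
  sign_cone e c -> resid e z 0 i * resid e z 0 i <= resid e z 0 i * (z - c) 0 i.
Proof.
move=> Cc; have := Cc i; rewrite !mxE; case: (e i) => [->|c0]; first by rewrite subr0.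
case: (leP 0 (z 0 i)) => z0; last by rewrite !mul0r.
by rewrite ler_wpM2l //; lra.
Qed.

Lemma ler_cvg_cst {R : realType} {I : Type} {F : set_system I} {FF : ProperFilter F}
    (a : I -> R) (l c : R) :
  a @ F --> l -> (\forall k \near F, c <= a k) -> c <= l.
Proof. by move=> al; apply: ler_cvg al; exact: cvg_cst. Qed.

Lemma cvg_inj {R : realType} {I : Type} {F : set_system I} {FF : ProperFilter F}
    (V : normedModType R) (a : I -> V) (l l' : V) :
  a @ F --> l -> a @ F --> l' -> l = l'.
Proof. by apply: cvg_unique; exact: norm_hausdorff. Qed.

Lemma rowBE {R : realType} {q : nat} (z w : 'rV[R]_q) i :
  (z - w) 0 i = z 0 i - w 0 i.
Proof. by rewrite !mxE. Qed.

Lemma rowZE {R : realType} {q : nat} (t : R) (z : 'rV[R]_q) i :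
  (t *: z) 0 i = t * z 0 i.
Proof. by rewrite mxE. Qed.

Section RobinsonStabilityCriterion.
Context {R : realType} {n m p1 p2 : nat}.
Local Notation X := 'rV[R]_n.
Local Notation Y := 'rV[R]_m.
Local Notation Q := 'rV[R]_(p1 + p2).
Local Notation isEq := (@eq_index p1 p2).
Variables (h : X * Y -> 'rV[R]_p1) (g : X * Y -> 'rV[R]_p2).
Hypotheses (h_C1 : cont_diff h) (g_C1 : cont_diff g).
Local Notation P := (Pmap h g).
Local Notation res z := (resid isEq (Pmap h g z)).

Let P_C1 : cont_diff P := Pmap_cont_diff h_C1 g_C1.

(* If stability fails, Ekeland's principle produces infeasible points that are
   almost stationary for the distance to C; along an ultrafilter the normalized
   residuals converge to a unit singular multiplier l, and the normalized
   increments to a direction (d, v) with w = d + D_y P v tangent and orthogonal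
   to l. *)
Lemma robinson_criterion xb y u : feas h g xb y ->
  (forall d, ImDx P xb y u d -> exists v, lin_feasible h g xb y d v) ->
  (forall w, Dset h g xb y u w ->
     forall mu gamma, singular_multiplier h g xb y mu gamma ->
       dotv gamma w.2 = 0 -> mu = 0 /\ gamma = 0) ->
  robinson_stable h g xb y u.
Proof.
move=> Fy lin_solvable no_singular; apply: contrapT => nRS.
have Cy : sign_cone isEq (P (xb, y)) by move: Fy; rewrite /feas /= CsetE.
have /choice [s Hs] : forall k : nat, exists s : X * Y, let e := (k.+1%:R)^-1 : R in
    [/\ dir_nbhd e e u s.1, `|s.2 - y| <= e, res (xb + s.1, s.2) <> 0 &
    forall v, - e * `|v| * enorm (res (xb + s.1, s.2)) <=
              dotv (res (xb + s.1, s.2)) ('d P (xb + s.1, s.2) (0, v))].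
  move=> k; have [|dx [y1 H]] := not_robinson_approx h_C1 g_C1 Fy nRS (e := (k.+1%:R)^-1).
    by rewrite invr_gt0.
  by exists (dx, y1).
pose dx k := (s k).1; pose yk k := (s k).2.
pose pk k : X * Y := (xb + dx k, yk k); pose zk k := res (pk k).
(* One ultrafilter serves the multipliers, both normalized increments and the rescaled residuals. *)
have [U [UU sU]] := @ultraFilterLemma _ (\oo : set_system nat) _.
have UP : ProperFilter U by exact: ultra_proper.
have toU (V : normedModType R) (a : nat -> V) (l : V) : a @ \oo --> l -> a @ U --> l.
  by move=> al; apply: cvg_trans al => A; exact: sU.
have eU : (fun k : nat => (k.+1%:R)^-1 : R) @ U --> (0 : R).
  by apply: toU; exact: cvg_harmonic.
have xU : (fun k => xb + dx k) @ U --> xb.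
  apply: toU; apply: cvg_harmonic_le => k; rewrite addrAC subrr add0r.
  have [[/ltW Hd _] _ _ _] := Hs k; exact: le_trans (norm_le_enorm _) Hd.
have yU : yk @ U --> y.
  by apply: toU; apply: cvg_harmonic_le => k; have [_ ] := Hs k.
have pU : pk @ U --> ((xb, y) : X * Y) by exact: (cvg_pair_normed xU yU).
have PU : (fun k => P (pk k)) @ U --> P (xb, y).
  by apply: cvg_comp pU _; exact: (cont_diff_continuous P_C1).
have zk0 k : zk k <> 0 by have [_ _] := Hs k.
have ez k : 0 < enorm (zk k) by exact: enorm_gt0.
pose lk k := (enorm (zk k))^-1 *: zk k.
have lk1 k : enorm (lk k) = 1.
  by rewrite enormZ gtr0_norm ?invr_gt0 // mulVf // lt0r_neq0.
have [l Ul] : exists l : Q, lk @ U --> l.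
  apply: (ultra_cvg_rV (M := 1)); apply: nearW => k.
  by rewrite -(lk1 k); exact: norm_le_enorm.
have l_unit : enorm l = 1.
  have H : (fun k => enorm (lk k)) @ U --> enorm l by exact: cvg_enorm.
  have E : (fun k => enorm (lk k)) = fun=> 1 by apply/funext => k; exact: lk1.
  by rewrite E in H; apply: (cvg_inj H); exact: cvg_cst.
have polar_l : polar_cone isEq (P (xb, y)) l.
  move=> i; case ei : (isEq i); [by left|right; split].
    apply: ler_cvg_cst (cvg_coord (i := i) Ul) _; apply: nearW => k.
    by rewrite [lk k 0 i]mxE mulr_ge0 ?invr_ge0 ?(ltW (ez k)) // /zk mxE ei le_max lexx.
  have H : (fun k => lk k 0 i * (P (pk k) - zk k) 0 i) @ U -->
           l 0 i * (P (xb, y) - res (xb, y)) 0 i.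
    apply: cvgM; first exact: cvg_coord.
    by apply: cvg_coord; apply: cvgB => //; exact: resid_cvg.
  rewrite (resid_sign_cone Cy) subr0 in H; apply: (cvg_inj H).
  have -> : (fun k => lk k 0 i * (P (pk k) - zk k) 0 i) = fun=> 0.
    by apply/funext => k; rewrite [lk k 0 i]mxE -mulrA dotv_resid_termwise mulr0.
  exact: cvg_cst.
have orth_ge v : 0 <= dotv l ('d P (xb, y) (0, v)).
  have H : (fun k => dotv (lk k) ('d P (pk k) (0, v))) @ U -->
           dotv l ('d P (xb, y) (0, v)).
    by apply: cvg_dotv => //; exact: cvg_cont_diff.
  have H' : (fun k : nat => - (k.+1%:R)^-1 * `|v|) @ U --> - 0 * `|v|.
    by apply: cvgM; [exact: cvgN|exact: cvg_cst].
  rewrite oppr0 mul0r in H'; apply: ler_cvg H' H _; apply: nearW => k.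
  have [_ _ _ /(_ v)] := Hs k; rewrite dotvZl -/(dx k) -/(yk k) -/(pk k) -/(zk k) => Hk.
  by rewrite ler_pdivlMl // mulrC.
have orth v : dotv l ('d P (xb, y) (0, v)) = 0.
  apply/eqP; rewrite eq_le orth_ge andbT.
  have := orth_ge (- v); have -> : (0, - v) = - (0, v) :> X * Y.
    by apply: (f_equal2 pair); rewrite ?oppr0.
  by rewrite linearN dotvNr oppr_ge0.
pose ak k := P (xb + dx k, y) - P (xb, y); pose bk k := yk k - y.
(* The scale measures the increment of [P] caused by [dx k], not [dx k] itself. Thus [d] falls in
   the image directional derivative, and [d] and [v] cannot both vanish. *)
pose tau k := `|ak k| + `|bk k|.
have tau0 k : 0 < tau k.
  rewrite lt0r addr_ge0 // andbT; apply/eqP => t0; apply: (zk0 k).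
  have a0 : ak k = 0 by apply/eqP; rewrite -normr_le0 -t0 lerDl.
  have b0 : bk k = 0 by apply/eqP; rewrite -normr_le0 -t0 lerDr.
  rewrite /zk /pk; have -> : yk k = y by rewrite -[RHS]add0r -b0 subrK.
  have -> : P (xb + dx k, y) = P (xb, y) by rewrite -[RHS]add0r -a0 subrK.
  exact: resid_sign_cone.
have tau_le k : `|(tau k)^-1 *: ak k| <= 1 /\ `|(tau k)^-1 *: bk k| <= 1.
  by rewrite !normrZ gtr0_norm ?invr_gt0 // !ler_pdivrMl // mulr1 lerDl lerDr.
have [d Ud] : exists d : Q, (fun k => (tau k)^-1 *: ak k) @ U --> d.
  by apply: (ultra_cvg_rV (M := 1)); apply: nearW => k; case: (tau_le k).
have [v Uv] : exists v : Y, (fun k => (tau k)^-1 *: bk k) @ U --> v.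
  by apply: (ultra_cvg_rV (M := 1)); apply: nearW => k; case: (tau_le k).
have dv_neq0 : ~ (d = 0 /\ v = 0).
  move=> [d0 v0].
  have H : (fun k => `|(tau k)^-1 *: ak k| + `|(tau k)^-1 *: bk k|) @ U --> `|d| + `|v|.
    by apply: cvgD; exact: cvg_norm.
  rewrite d0 v0 !normr0 addr0 in H.
  suff : 1 <= 0 :> R by rewrite ler10.
  apply: ler_cvg_cst H _; apply: nearW => k.
  by rewrite !normrZ gtr0_norm ?invr_gt0 // -mulrDr mulVf // lt0r_neq0.
have Imd : ImDx P xb y u d.
  apply: (@ImDx_limit _ _ _ _ P xb y u U _ dx tau d) => // r r0.
  have : \forall k \near U, (k.+1%:R)^-1 < r by exact: (cvgr_lt _ eU).
  apply: filterS => k kr.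
  by have [Hd _ _ _] := Hs k; apply: dir_nbhd_mono Hd; exact: ltW.
pose w := d + 'd P (xb, y) (0, v).
pose wk k := (tau k)^-1 *: (P (pk k) - P (xb, y)).
(* The increment is split at the point [(xb + dx k, y)]: its first part gives [d], the second is
   handled by strict differentiability in [y]. *)
have Uw : wk @ U --> w.
  have -> : wk = fun k => (tau k)^-1 *: ak k +
                 (tau k)^-1 *: (P (pk k) - P (xb + dx k, y)).
    by apply/funext => k; rewrite /wk -scalerDr [in RHS]addrC addrA subrK.
  apply: cvgD => //; apply: diff_quotient_cvg => //.
  - by apply: cvg_pair_normed => //; exact: cvg_cst.
  - exact: nearW.
  - have -> : (fun k => (tau k)^-1 *: (pk k - (xb + dx k, y))) =
              fun k => (0, (tau k)^-1 *: bk k).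
      apply/funext => k; apply: (f_equal2 pair) => //=.
      by rewrite subrr scaler0.
    by apply: cvg_pair_normed => //; exact: cvg_cst.
pose ck k := (tau k)^-1 *: zk k.
have ck_sqr k i : ck k 0 i * ck k 0 i <= ck k 0 i * wk k 0 i.
  have t20 : 0 <= (tau k)^-1 * (tau k)^-1 by rewrite mulr_ge0 // invr_ge0 ltW.
  have := ler_wpM2l t20 (resid_sqr_le (P (pk k)) i Cy).
  rewrite /ck /wk !rowZE -/(zk k).
  by rewrite !mulrA ![_ * zk k 0 i * _]mulrAC ![_ * (tau k)^-1 * zk k 0 i]mulrAC.
have [c Uc] : exists c : Q, ck @ U --> c.
  have Hw : (fun k => `|wk k|) @ U --> `|w| by exact: cvg_norm.
  apply: (ultra_cvg_rV (M := `|w| + 1)).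
  have : \forall k \near U, `|wk k| < `|w| + 1 by apply: (cvgr_lt _ Hw); lra.
  apply: filterS => k Hk; apply: le_trans (ltW Hk); apply: rV_norm_le => // i.
  apply: le_trans (coord_le_norm _ i).
  rewrite /ck /wk !rowZE !normrM ler_wpM2l //; exact: resid_coord_le.
have c_l : c = enorm c *: l.
  apply: (cvg_inj Uc).
  have -> : ck = fun k => enorm (ck k) *: lk k.
    apply/funext => k; rewrite /ck /lk enormZ gtr0_norm ?invr_gt0 // scalerA.
    by rewrite -mulrA divff ?mulr1 // lt0r_neq0.
  by apply: cvgZ => //; exact: cvg_enorm.
have lw_ge0 i : 0 <= l 0 i * w 0 i.
  have H : (fun k => lk k 0 i * wk k 0 i) @ U --> l 0 i * w 0 i.
    by apply: cvgM; exact: cvg_coord.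
  apply: ler_cvg_cst H _; apply: nearW => k.
  rewrite /lk /wk !rowZE mulrACA mulr_ge0 //.
    by rewrite mulr_ge0 // invr_ge0 ltW.
  by apply: le_trans (resid_sqr_le (P (pk k)) i Cy); rewrite -expr2 sqr_ge0.
(* As [l] annihilates the range of [D_y P], [dotv l w] does not change when [v] is replaced by [v0],
   for which tangency gives the sign. *)
have [v0 /(lin_feasibleP h_C1 g_C1) Tv0] := lin_solvable d Imd.
have lw_le0 : dotv l w <= 0.
  have := polar_dotv_le0 polar_l Tv0; rewrite dotvDr orth addr0.
  by rewrite /w dotvDr orth addr0.
have lw0 i : l 0 i * w 0 i = 0.
  have /psumr_eq0P : forall i, true -> 0 <= l 0 i * w 0 i by [].
  by apply => //; apply/eqP; rewrite eq_le lw_le0; apply: sumr_ge0.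
(* [c] is a multiple of [l], hence termwise orthogonal to [w], and [ck_sqr] bounds its squares by
   these products. *)
have c0 : c = 0.
  apply/rowP => i; rewrite mxE; apply/eqP; rewrite -sqrf_eq0 eq_le sqr_ge0 andbT expr2.
  have cw : c 0 i * w 0 i = 0 by rewrite c_l rowZE -mulrA lw0 mulr0.
  have H1 : (fun k => ck k 0 i * ck k 0 i) @ U --> c 0 i * c 0 i.
    by apply: cvgM; exact: cvg_coord.
  have H2 : (fun k => ck k 0 i * wk k 0 i) @ U --> c 0 i * w 0 i.
    by apply: cvgM; exact: cvg_coord.
  rewrite -cw; apply: ler_cvg H1 H2 _; exact: nearW.
(* For an equality coordinate [wk] and [ck] agree; for an active inequality [wk] is at most [ck].
   Both statements pass to the limit since [c = 0]. *)
have Tw : tangent_cone isEq (P (xb, y)) w.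
  move=> i; have ci : (fun k => ck k 0 i) @ U --> (0 : R).
    have := cvg_coord (i := i) Uc; rewrite c0 mxE; exact.
  have wi : (fun k => wk k 0 i) @ U --> w 0 i by exact: cvg_coord.
  have := Cy i; case ei : (isEq i) => P0.
    apply: (cvg_inj wi); apply: cvg_trans ci; apply: near_eq_cvg.
    apply: nearW => k; rewrite /ck /wk !rowZE; congr (_ * _).
    by rewrite rowBE P0 subr0 /zk mxE ei.
  move=> P00; apply: ler_cvg wi ci _; apply: nearW => k.
  rewrite /ck /wk !rowZE ler_pM2l ?invr_gt0 //.
  by rewrite rowBE P00 subr0 /zk [res (pk k) 0 i]mxE ei le_max lexx orbT.
have [] := no_singular _ (ex_intro _ d (ex_intro _ v (And4 dv_neq0 Imd
  ((lin_feasibleP h_C1 g_C1 xb y d v).2 Tw) erefl))) (lsubmx l) (rsubmx l).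
- exact: polar_singular.
- rewrite /=; apply: big1 => i _; have := lw0 (rshift p1 i).
  by rewrite /w dPmap_y // [(d + _) 0 _]mxE row_mxEr [rsubmx l 0 i]mxE
             [(rsubmx d + _) 0 i]mxE [rsubmx d 0 i]mxE.
- move=> l1 l2; have l0 : l = 0 by rewrite -[l]hsubmxK l1 l2 row_mx0.
  by move: l_unit; rewrite l0 enorm0 => /esym/eqP; rewrite oner_eq0.
Qed.

End RobinsonStabilityCriterion.

(** * Curves of feasible points and the upper estimate *)

Section Transport.
Context {R : realType} {n m p1 p2 : nat}.
Local Notation X := 'rV[R]_n.
Local Notation Y := 'rV[R]_m.
Local Notation Q := 'rV[R]_(p1 + p2).
Local Notation isEq := (@eq_index p1 p2).
Variables (f : X * Y -> R) (h : X * Y -> 'rV[R]_p1) (g : X * Y -> 'rV[R]_p2).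
Hypotheses (f_C1 : cont_diff f) (h_C1 : cont_diff h) (g_C1 : cont_diff g).
Local Notation P := (Pmap h g).
Local Notation res z := (resid isEq (Pmap h g z)).

Let P_C1 : cont_diff P := Pmap_cont_diff h_C1 g_C1.

Section AlongFilter.
Context {I : Type} {F : set_system I} {FF : Filter F}.
Variables (xb : X) (y : Y) (x : I -> X) (yk : I -> Y) (t : I -> R) (uk : I -> X).
Variables (u0 : X) (v : Y).
Hypotheses (Fy : feas h g xb y) (xF : x @ F --> xb) (yF : yk @ F --> y).
Hypothesis feasF : \forall k \near F, feas h g (x k) (yk k).
Hypotheses (tF : t @ F --> 0) (tp : \forall k \near F, 0 < t k) (uF : uk @ F --> u0).
Hypothesis Tv : tangent_cone isEq (P (xb, y)) ('d P (xb, y) (u0, v)).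

Let x' k := x k + t k *: uk k.
Let y' k := yk k + t k *: v.

Let x'F : x' @ F --> xb.
Proof.
by rewrite -[xb]addr0 -(scale0r u0); apply: cvgD => //; exact: cvgZ.
Qed.

Let y'F : y' @ F --> y.
Proof.
rewrite -[y]addr0 -(scale0r v); apply: cvgD => //; apply: cvgZ => //; exact: cvg_cst.
Qed.

Let zk k : X * Y := (x k, yk k).
Let zk' k : X * Y := (x' k, y' k).

Let zkF : zk @ F --> ((xb, y) : X * Y).
Proof. exact: (cvg_pair_normed xF yF). Qed.

Let zk'F : zk' @ F --> ((xb, y) : X * Y).
Proof. exact: (cvg_pair_normed x'F y'F). Qed.

Let direction_cvg (yh : I -> Y) :
  (fun k => (t k)^-1 *: (yh k - y' k)) @ F --> (0 : Y) ->
  (fun k => (t k)^-1 *: (((x' k, yh k) : X * Y) - zk k)) @ F --> ((u0, v) : X * Y).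
Proof.
move=> yh0.
have E : \forall k \near F, ((uk k, v + (t k)^-1 *: (yh k - y' k)) : X * Y) =
                   (t k)^-1 *: (((x' k, yh k) : X * Y) - zk k).
  apply: filterS tp => k tk; apply: (f_equal2 pair) => /=.
    by rewrite /x' addrAC subrr add0r scalerA mulVf ?scale1r // lt0r_neq0.
  rewrite /y' opprD addrA [_ - t k *: v]addrC scalerDr scalerN scalerA.
  by rewrite mulVf ?lt0r_neq0 // scale1r addrA subrr add0r.
apply: cvg_trans (near_eq_cvg E) _.
apply: cvg_pair_normed => //; rewrite -[X in _ --> X]addr0.
by apply: cvgD => //; exact: cvg_cst.
Qed.

(** An equality residual divided by [t k] is the difference quotient, which tends to 0 by tangency.
    An inactive inequality remains negative. For an active one, feasibility of the base point bounds
    the residual by the positive part of the increment, and the derivative is nonpositive. *)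
Let resid_small : (fun k => (t k)^-1 *: res (zk' k)) @ F --> (0 : Q).
Proof.
have dq : (fun k => (t k)^-1 *: (P (zk' k) - P (zk k))) @ F --> 'd P (xb, y) (u0, v).
  apply: diff_quotient_cvg => //; apply: (direction_cvg (yh := y')).
  under eq_fun do rewrite subrr scaler0; exact: cvg_cst.
apply: cvg_rV => i; rewrite mxE.
have dqi := cvg_coord (i := i) dq.
have Ti := Tv i; have Fi : if isEq i then P (xb, y) 0 i = 0 else P (xb, y) 0 i <= 0.
  by move: Fy; rewrite /feas /= CsetE => /(_ i).
have feasi : \forall k \near F, if isEq i then P (zk k) 0 i = 0 else P (zk k) 0 i <= 0.
  by apply: filterS feasF => k; rewrite /feas /= CsetE => /(_ i).
case ei : (isEq i) in Ti Fi feasi.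
  rewrite -Ti; apply: cvg_trans dqi; apply: near_eq_cvg.
  by apply: filterS feasi => k Pk0; rewrite !rowZE rowBE Pk0 subr0 [res _ 0 i]mxE ei.
have [P0|Pn0] := eqVneq (P (xb, y) 0 i) 0; last first.
  have Plt : P (xb, y) 0 i < 0 by rewrite lt_neqAle Pn0.
  have PF : (fun k => P (zk' k) 0 i) @ F --> P (xb, y) 0 i.
    apply: cvg_coord; apply: cvg_comp zk'F _; exact: (cont_diff_continuous P_C1).
  apply: (@cvg_trans _ ((fun=> 0 : R) @ F)); last exact: cvg_cst.
  apply: near_eq_cvg; have : \forall k \near F, P (zk' k) 0 i < 0.
    exact: (cvgr_lt _ PF).
  apply: filterS => k Pk; rewrite rowZE [res _ 0 i]mxE ei (max_idPl _) ?mulr0 //.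
  exact: ltW.
have maxF : (fun k => Num.max 0 (((t k)^-1 *: (P (zk' k) - P (zk k))) 0 i)) @ F --> (0 : R).
  have := cvg_max0 dqi; rewrite (max_idPl (Ti P0)); exact.
apply: cvg_norm0 maxF _.
apply: filterS2 feasi tp => k Pk tk; rewrite rowZE [res _ 0 i]mxE ei.
have t0 : 0 <= (t k)^-1 by rewrite invr_ge0 ltW.
rewrite ger0_norm; last by rewrite mulr_ge0 // le_max lexx.
case: (leP 0 (P (zk' k) 0 i)) => _; last by rewrite mulr0 le_max lexx.
by rewrite rowZE le_max; apply/orP; right; rewrite ler_wpM2l // rowBE; lra.
Qed.

(** Stability corrects [yk k + t k *: v] by [o(t k)], since the residual there is [o(t k)], so [f]
    changes to first order as along the straight step. The neighbourhood condition concerns the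
    arrival parameter: the base may be [xb] itself, or a perturbed parameter from which one returns
    to [xb]. *)
Lemma robinson_transport u c : robinson_stable h g xb y u ->
  (forall e delta, 0 < e -> 0 < delta -> \forall k \near F,
     dir_nbhd e delta u (x k + t k *: uk k - xb)) ->
  'd f (xb, y) (u0, v) < c ->
  \forall k \near F, exists2 yh, feas h g (x k + t k *: uk k) yh &
    f (x k + t k *: uk k, yh) <= f (x k, yk k) + t k * c.
Proof.
move=> [_ [kappa [e [delta [kappa0 e0 d0 stable]]]]] Hdir fc.
(* The term [t k * t k] makes the distance bound strict, so that a feasible point within it exists,
   and still vanishes after division by [t k]. *)
pose rk k := kappa * enorm (res (zk' k)) + t k * t k.
have near_feas : \forall k \near F, exists2 yh, feas h g (x' k) yh & enorm (yh - y' k) < rk k.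
  have Hy : \forall k \near F, enorm (y' k - y) < e.
    have H : (fun k => enorm (y' k - y)) @ F --> (0 : R).
      by rewrite -(enorm0 m) -(subrr y); apply: cvg_enorm; apply: cvgB => //; exact: cvg_cst.
    exact: (cvgr_lt _ H).
  apply: filterS3 (Hdir e delta e0 d0) Hy tp => k H1 H2 tk.
  have := stable _ _ H1 H2.
  rewrite edistv_Cset -EFinM ![xb + _]addrC ![y + _]addrC !subrK -/(x' k) -/(y' k) -/(zk' k).
  move=> H3; have : (edistv (y' k) (feas h g (x' k)) < (rk k)%:E)%E.
    by apply: le_lt_trans H3 _; rewrite lte_fin /rk ltrDl mulr_gt0.
  move=> /ereal_inf_lt [_ [yh Fyh <-]]; rewrite lte_fin => Hlt.
  by exists yh => //; rewrite -enormN opprB.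
have /choice [yh Hyh] : forall k, exists yh,
    (exists2 yh, feas h g (x' k) yh & enorm (yh - y' k) < rk k) ->
    feas h g (x' k) yh /\ enorm (yh - y' k) < rk k.
  move=> k.
  have [[yh H1 H2]|N] :=
    pselect (exists2 yh, feas h g (x' k) yh & enorm (yh - y' k) < rk k).
    by exists yh.
  by exists 0.
have yhF : (fun k => (t k)^-1 *: (yh k - y' k)) @ F --> (0 : Y).
  have bF : (fun k => kappa * enorm ((t k)^-1 *: res (zk' k)) + t k) @ F --> (0 : R).
    rewrite -[X in _ --> X]addr0; apply: cvgD => //.
    rewrite -(mulr0 kappa) -(enorm0 (p1 + p2)).
    exact: (cvgM (cvg_cst kappa) (cvg_enorm resid_small)).
  apply: cvg_norm0 bF _; apply: filterS2 near_feas tp => k /Hyh [_ H] tk.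
  rewrite normrZ enormZ gtr0_norm ?invr_gt0 // ler_pdivrMl //.
  apply: le_trans (norm_le_enorm _) _; apply: le_trans (ltW H) _.
  rewrite /rk mulrDr lerD2r mulrCA [t k * _]mulrA divff ?mul1r // lt0r_neq0 //.
have fq : (fun k => (t k)^-1 * (f (x' k, yh k) - f (zk k))) @ F --> 'd f (xb, y) (u0, v).
  apply: (diff_quotient_cvg_real (a := fun k => (x' k, yh k) : X * Y)) => //;
    last exact: direction_cvg.
  apply: cvg_pair_normed => //.
  have E : \forall k \near F, y' k + t k *: ((t k)^-1 *: (yh k - y' k)) = yh k.
    by apply: filterS tp => k tk; rewrite scalerA divff ?lt0r_neq0 // scale1r addrC subrK.
  apply: cvg_trans (near_eq_cvg E) _; rewrite -[y]addr0 -(scale0r (0 : Y)).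
  by apply: cvgD => //; exact: cvgZ.
have fqc : \forall k \near F, (t k)^-1 * (f (x' k, yh k) - f (zk k)) < c.
  exact: (cvgr_lt _ fq).
apply: filterS3 near_feas fqc tp => k /Hyh [H1 H2] H3 tk; exists (yh k) => //.
by rewrite -lerBlDl -ler_pdivrMl // ltW.
Qed.

End AlongFilter.

Variables (xb u : X) (y : Y).
Hypotheses (Sy : sol f h g xb y) (RS : robinson_stable h g xb y u).

Let Fy : feas h g xb y := Sy.1.

(** Directional neighbourhoods contain 0, so stability acts as a constraint qualification for the
    problem at [xb]: without a multiplier there would be a linearized descent direction, and
    transporting it with parameter direction 0 would contradict optimality of [y]. *)
Lemma multipliers_exist : multipliers f h g xb y !=set0.
Proof.
have t0 : (fun t : R => t) @ (0 : R)^'+ --> (0 : R) by exact: cvg_at_right_filter.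
have tp : \forall t \near (0 : R)^'+, 0 < t by exact: nbhs_right_gt.
case: (program_farkas f_C1 h_C1 g_C1 0 (-1) Fy) => [[v Tv fv]|[[l [_ _]]|[l Ml _]]].
- rewrite add0r in Tv.
  (* The rate [- 2^-1] is an arbitrary choice strictly between -1 and 0: transport needs room above
     the slope, and a contradiction needs a negative rate. *)
  have H : \forall t \near (0 : R)^'+, exists2 yh, feas h g (xb + t *: (0 : X)) yh &
      f (xb + t *: (0 : X), yh) <= f (xb, y) + t * (- 2^-1).
    apply: (robinson_transport (I := R) (x := fun=> xb) (yk := fun=> y) (t := fun t => t)
      (uk := fun=> 0) Fy _ _ _ t0 tp _ Tv RS); try exact: cvg_cst.
    - exact: nearW.
    - move=> e delta e0 d0; apply: nearW => t.
      by rewrite scaler0 addr0 subrr; exact: dir_nbhd0.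
    - by lra.
  have [t [t1 [yh Fyh Hyh]]] : exists t : R, 0 < t /\
      exists2 yh, feas h g (xb + t *: (0 : X)) yh &
      f (xb + t *: (0 : X), yh) <= f (xb, y) + t * (- 2^-1).
    by apply: (@filter_ex _ (0 : R)^'+); apply: filterS2 tp H.
  rewrite scaler0 addr0 in Fyh Hyh; have := Sy.2 _ Fyh.
  by move=> /le_trans/(_ Hyh); rewrite lerDl pmulr_rge0 // oppr_ge0 invr_le0 lern0.
- by rewrite dotv0r ltxx.
- by exists l.
Qed.

Lemma ImDx_dPmap : ImDx P xb y u ('d P (xb, y) (u, 0)).
Proof.
have t0 : (fun k : nat => (k.+1%:R)^-1 : R) @ \oo --> (0 : R) by exact: cvg_harmonic.
have tp k : 0 < (k.+1%:R)^-1 :> R by rewrite invr_gt0.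
apply: (@ImDx_limit _ _ _ _ P xb y u \oo _ (fun k => (k.+1%:R)^-1 *: u)
          (fun k => (k.+1%:R)^-1)) => //.
  move=> r r0; apply: near_dir_nbhd => //; first exact: nearW.
  exact: cvg_cst.
apply: diff_quotient_cvg => //.
- apply: cvg_pair_normed; last exact: cvg_cst.
  rewrite -[X in _ --> X]addr0 -(scale0r u); apply: cvgD; first exact: cvg_cst.
  by apply: cvgZ => //; exact: cvg_cst.
- exact: cvg_cst.
- exact: nearW.
- have -> : (fun k : nat => (k.+1%:R)^-1^-1 *: ((xb + (k.+1%:R)^-1 *: u, y) - (xb, y) : X * Y)) =
      fun=> (u, 0).
    apply/funext => k; apply: (f_equal2 pair) => /=; last by rewrite subrr scaler0.
    by rewrite addrAC subrr add0r scalerA mulVf ?scale1r // lt0r_neq0.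
  exact: cvg_cst.
Qed.

Hypothesis lin_solvable :
  forall d, ImDx P xb y u d -> exists v, lin_feasible h g xb y d v.
Hypothesis regular : forall v, (exists2 d, ImDx P xb y u d & lin_feasible h g xb y d v) ->
  forall mu gamma, singular_multiplier h g xb y mu gamma ->
    dotv mu (Jxy h xb y u v) = 0 -> dotv gamma (Jxy g xb y u v) = 0 ->
    mu = 0 /\ gamma = 0.

(** A solution [v] of the linearized system for ['d P (xb, y) (u, 0)] makes the terms of [dotv l w]
    nonpositive while their sum is nonnegative; all vanish, and these are the orthogonality
    conditions of [regular]. *)
Lemma singular_eq0 l : polar_cone isEq (P (xb, y)) l ->
  (forall v, dotv l ('d P (xb, y) (0, v)) = 0) ->
  0 <= dotv l ('d P (xb, y) (u, 0)) -> l = 0.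
Proof.
move=> pl ol lq.
have [v /[dup] lfv /(lin_feasibleP h_C1 g_C1) Tv] := lin_solvable ImDx_dPmap.
set w := _ + _ in Tv.
have w_uv : w = 'd P (xb, y) (u, v) by exact/esym/dsplit.
have lw_le i : l 0 i * w 0 i <= 0 by exact: polar_termwise pl Tv i.
have lw_ge : 0 <= dotv l w by rewrite /w dotvDr ol addr0.
have lw0 i : l 0 i * w 0 i = 0.
  have /psumr_eq0P : forall i, true -> 0 <= - (l 0 i * w 0 i).
    by move=> j _; rewrite oppr_ge0.
  rewrite sumrN => H; apply/eqP; rewrite -oppr_eq0; apply/eqP; apply: H => //.
  apply/eqP; rewrite oppr_eq0 eq_le lw_ge andbT; apply: sumr_le0 => j _; exact: lw_le.
rewrite w_uv dPmap_Jxy // in lw0.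
have [] := regular (ex_intro2 _ _ _ ImDx_dPmap lfv) (polar_singular h_C1 g_C1 pl ol).
- apply: big1 => i _; have := lw0 (lshift p2 i); rewrite row_mxEl.
  by rewrite [lsubmx l 0 i]mxE.
- apply: big1 => i _; have := lw0 (rshift p1 i); rewrite row_mxEr.
  by rewrite [rsubmx l 0 i]mxE.
- by move=> l1 l2; rewrite -[l]hsubmxK l1 l2 row_mx0.
Qed.

Lemma value_upper_bound (b e : R) : 0 < e ->
  (forall l, multipliers f h g xb y l -> lagr_dx f h g xb y l u <= b) ->
  \forall tu \near filter_prod (0 : R)^'+ (nbhs u),
    (value f h g (xb + tu.1 *: tu.2) <= (f (xb, y) + tu.1 * (b + e))%:E)%E.
Proof.
move=> e0 lagr_le.
have [v Tv fv] : exists2 v, tangent_cone isEq (P (xb, y)) ('d P (xb, y) (u, v)) &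
    'd f (xb, y) (u, v) <= b.
  (* The threshold is [b] without the contribution of [u] to [f], so the third alternative would be
     a multiplier whose sensitivity exceeds [b]. *)
  case: (program_farkas f_C1 h_C1 g_C1 ('d P (xb, y) (u, 0))
    (b - 'd f (xb, y) (u, 0)) Fy) => [[v Tv fv]|[[l [pl ol lq]]|[l Ml lq]]].
  - by exists v; rewrite dsplit // addrC -lerBrDr.
  - have l0 := singular_eq0 pl ol (ltW lq).
    by move: lq; rewrite l0 dotv0l ltxx.
  - have := lagr_le l Ml; rewrite (lagr_dxE _ _ (f_C1.1 _) (P_C1.1 _)).
    by rewrite -lerBrDl leNgt lq.
pose F := filter_prod (0 : R)^'+ (nbhs u).
have t0 : (fun tu : R * X => tu.1) @ F --> (0 : R).
  apply: cvg_trans; first exact: cvg_fst.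
  by apply: cvg_within.
have tp : \forall tu \near F, 0 < tu.1.
  exists ([set t | 0 < t], setT); last by move=> [t u'] [].
  by split; [exact: nbhs_right_gt|exact: filterT].
have uF : (fun tu : R * X => tu.2) @ F --> u by exact: cvg_snd.
have H : \forall tu \near F, exists2 yh, feas h g (xb + tu.1 *: tu.2) yh &
    f (xb + tu.1 *: tu.2, yh) <= f (xb, y) + tu.1 * (b + e).
  apply: (robinson_transport (x := fun=> xb) (yk := fun=> y) (t := fun tu => tu.1)
    (uk := fun tu => tu.2) Fy _ _ _ t0 tp uF Tv RS); try exact: cvg_cst.
  - exact: nearW.
  - move=> e' delta e'0 d0; have H : \forall tu \near F, dir_nbhd e' delta u (tu.1 *: tu.2).
      exact: near_dir_nbhd.
    by apply: filterS H => tu; rewrite addrAC subrr add0r.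
  - by rewrite (le_lt_trans fv) // ltrDl.
apply: filterS H => tu [yh Fyh Hyh].
apply: (@le_trans _ _ (f (xb + tu.1 *: tu.2, yh))%:E); last by rewrite lee_fin.
by apply: ereal_inf_lbound; exists yh.
Qed.

End Transport.

(** * Directional solutions and the lower estimate *)

Section DirectionalSolutions.
Context {R : realType} {n m p1 p2 : nat}.
Local Notation X := 'rV[R]_n.
Local Notation Y := 'rV[R]_m.
Local Notation Q := 'rV[R]_(p1 + p2).
Local Notation isEq := (@eq_index p1 p2).
Variables (f : X * Y -> R) (h : X * Y -> 'rV[R]_p1) (g : X * Y -> 'rV[R]_p2).
Hypotheses (f_C1 : cont_diff f) (h_C1 : cont_diff h) (g_C1 : cont_diff g).
Local Notation P := (Pmap h g).

Let P_C1 : cont_diff P := Pmap_cont_diff h_C1 g_C1.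

Lemma sol_value x y : sol f h g x y -> value f h g x = (f (x, y))%:E.
Proof.
move=> [Fy miny]; apply/eqP; rewrite eq_le; apply/andP; split.
  by apply: ereal_inf_lbound; exists y.
by apply: le_ereal_inf_tmp => _ [y' Fy' <-]; rewrite lee_fin; exact: miny.
Qed.

Lemma feas_limit {I : Type} {F : set_system I} {FF : ProperFilter F}
    (x : I -> X) (y : I -> Y) xb yb :
  x @ F --> xb -> y @ F --> yb -> (\forall k \near F, feas h g (x k) (y k)) ->
  feas h g xb yb.
Proof.
move=> xF yF Fk; rewrite /feas /= CsetE => i.
have PF : (fun k => P (x k, y k) 0 i) @ F --> P (xb, yb) 0 i.
  apply: cvg_coord; apply: cvg_comp (cvg_pair_normed xF yF) _.
  exact: (cont_diff_continuous P_C1).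
have Pk : \forall k \near F, if isEq i then P (x k, y k) 0 i = 0 else P (x k, y k) 0 i <= 0.
  by apply: filterS Fk => k; rewrite /feas /= CsetE => /(_ i).
case ei : (isEq i) in Pk *.
  apply: (cvg_inj PF); apply: (@cvg_trans _ ((fun=> 0 : R) @ F)); last exact: cvg_cst.
  by apply: near_eq_cvg; apply: filterS Pk => k.
by apply: ler_cvg PF (cvg_cst _) Pk.
Qed.

Lemma sol_limit {I : Type} {F : set_system I} {FF : ProperFilter F}
    (x : I -> X) (y : I -> Y) (e : I -> R) xb yb :
  x @ F --> xb -> y @ F --> yb -> e @ F --> 0 ->
  (\forall k \near F, feas h g (x k) (y k) /\
     forall y', feas h g xb y' -> f (x k, y k) <= f (xb, y') + e k) ->
  sol f h g xb yb.
Proof.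
move=> xF yF eF Hk; split.
  by apply: feas_limit xF yF _; apply: filterS Hk => k [].
move=> y' Fy'.
have fF : (fun k => f (x k, y k)) @ F --> f (xb, yb).
  apply: cvg_comp (cvg_pair_normed xF yF) _; exact: (cont_diff_continuous f_C1).
have eF' : (fun k => f (xb, y') + e k) @ F --> f (xb, y') + 0.
  by apply: cvgD => //; exact: cvg_cst.
rewrite addr0 in eF'; apply: ler_cvg fF eF' _.
by apply: filterS Hk => k [_]; apply.
Qed.

(** Solutions are obtained along ultrafilters over arbitrary index types; this form avoids building
    the sequences each time and makes the diagonal argument for closedness immediate. *)
Lemma dir_solP xb u y : dir_sol f h g xb u y <-> sol f h g xb y /\
  forall r : R, 0 < r -> exists t us ys,
    [/\ 0 < t < r, `|us - u| < r, `|ys - y| < r & sol f h g (xb + t *: us) ys].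
Proof.
split=> [[Sy [t [us [ys [[tp t0] usu ysy Sk]]]]]|[Sy H]]; split=> //.
  move=> r r0.
  move/cvgr0Pnorm_lt : t0 => /(_ r r0) H1.
  move/cvgrPdistC_lt : usu => /(_ r r0) H2.
  move/cvgrPdistC_lt : ysy => /(_ r r0) H3.
  have [k [h1 h2 h3]] : exists k, [/\ `|t k| < r, `|us k - u| < r & `|ys k - y| < r].
    by apply: (@filter_ex _ (\oo : set_system nat)); apply: filterS3 H1 H2 H3.
  exists (t k), (us k), (ys k); split=> //.
  by rewrite tp /=; rewrite gtr0_norm in h1.
have /choice [s Hs] : forall k : nat, exists s : R * X * Y, let r := (k.+1%:R)^-1 in
    [/\ 0 < s.1.1 < r, `|s.1.2 - u| < r, `|s.2 - y| < r &
        sol f h g (xb + s.1.1 *: s.1.2) s.2].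
  move=> k; have [|t [us [ys Hk]]] := H (k.+1%:R)^-1; first by rewrite invr_gt0.
  by exists (t, us, ys).
exists (fun k => (s k).1.1), (fun k => (s k).1.2), (fun k => (s k).2); split.
- split=> [k|]; first by have [/andP[]] := Hs k.
  apply: cvg_harmonic_le => k; have [/andP[t0 tk] _ _ _] := Hs k.
  by rewrite subr0 gtr0_norm // ltW.
- by apply: cvg_harmonic_le => k; have [_ /ltW] := Hs k.
- by apply: cvg_harmonic_le => k; have [_ _ /ltW] := Hs k.
- by move=> k; have [] := Hs k.
Qed.

Lemma closed_eps (q : nat) (A : set 'rV[R]_q) :
  (forall y, (forall r : R, 0 < r -> exists2 y', A y' & `|y' - y| < r) -> A y) ->
  closed A.
Proof.
move=> H y cAy; apply: H => r r0.
have [y' [Ay' By']] := cAy _ (nbhsx_ballx y r r0).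
by exists y' => //; move: By'; rewrite -ball_normE /ball_ /= distrC.
Qed.

Lemma dir_sol_closed xb u : closed (dir_sol f h g xb u).
Proof.
apply: closed_eps => y H; apply/dir_solP; split.
  have /choice [ys Hys] : forall k : nat, exists ys, dir_sol f h g xb u ys /\
      `|ys - y| < (k.+1%:R)^-1.
    move=> k; have [|y' Hy' ltr] := H (k.+1%:R)^-1; first by rewrite invr_gt0.
    by exists y'.
  apply: (@sol_limit nat \oo _ (fun=> xb) ys (fun=> 0)); try exact: cvg_cst.
    by apply: cvg_harmonic_le => k; have [_ /ltW] := Hys k.
  apply: nearW => k; have [[[Fk mink] _] _] := Hys k; split=> // y' Fy'.
  by rewrite addr0; exact: mink.
move=> r r0; have r20 : 0 < r / 2 by lra.
have [y' /dir_solP [_ /(_ _ r20) [t [us [ys [h1 h2 h3 h4]]]]] hy'] := H _ r20.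
exists t, us, ys; split=> //; [by lra|by lra|].
have : `|ys - y| <= `|ys - y'| + `|y' - y| by rewrite -(subrKA y') ler_normD.
by lra.
Qed.

Variables (xb u : X) (Om : set Y).
Hypothesis ric : restricted_inf_compactness f h g xb u Om.
Hypothesis RS : forall y, (sol f h g xb `&` Om) y -> robinson_stable h g xb y u.

Lemma ric_sol_nonempty : sol f h g xb `&` Om !=set0.
Proof.
have [_ fin [e [delta [e0 d0 H]]]] := ric.
have := H 0 (dir_nbhd0 delta u e0); rewrite addr0; apply.
by rewrite -(fineK fin) -EFinD lte_fin ltrDl.
Qed.

(** [y] is a limit of solutions at the perturbed parameters. Were [c < b], duality in direction
    [- u] would give a [v] of rate below [- c]; stepping back from those solutions would then reach
    a feasible point at [xb] with value below the optimum. Lower bounds [b] are used because the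
    infimum over multipliers may be [-oo]. *)
Lemma lower_bound_witness {I : Type} {U : set_system I} {UU : UltraFilter U}
    (t : I -> R) (uk : I -> X) (c : R) :
  t @ U --> 0 -> (\forall k \near U, 0 < t k) -> uk @ U --> u ->
  (\forall k \near U,
     (value f h g (xb + t k *: uk k) < value f h g xb + (t k * c)%:E)%E) ->
  exists2 y, (dir_sol f h g xb u `&` Om) y &
    forall b, (forall l, multipliers f h g xb y l -> b <= lagr_dx f h g xb y l u) ->
      b <= c.
Proof.
move=> tU tp uU small.
have UP : ProperFilter U by exact: ultra_proper.
have [cOm fin [e [delta [e0 d0 H]]]] := ric.
have [y0 [Sy0 Oy0]] := ric_sol_nonempty.
set V := f (xb, y0); have VE : value f h g xb = V%:E by exact: sol_value.
pose x k := xb + t k *: uk k.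
have xU : x @ U --> xb.
  by rewrite -[xb]addr0 -(scale0r u); apply: cvgD; [exact: cvg_cst|exact: cvgZ].
have tcU : (fun k => t k * c) @ U --> (0 : R).
  by rewrite -(mul0r c); apply: cvgM => //; exact: cvg_cst.
have near_sol : \forall k \near U, (sol f h g (x k) `&` Om !=set0) /\
    (value f h g (x k) < (V + t k * c)%:E)%E.
  have H1 : \forall k \near U, dir_nbhd e delta u (t k *: uk k) by exact: near_dir_nbhd.
  have H2 : \forall k \near U, t k * c < e by exact: (cvgr_lt _ tcU).
  apply: filterS3 H1 H2 small => k h1 h2; rewrite -/(x k) VE -EFinD => h3.
  split=> //; apply: H => //; rewrite -/(x k) VE -EFinD; apply: lt_trans h3 _.
  by rewrite lte_fin ltrD2l.
have /choice [yk Hyk] : forall k, exists y,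
    sol f h g (x k) `&` Om !=set0 -> (sol f h g (x k) `&` Om) y.
  move=> k; have [[y Hy]|N] := pselect (sol f h g (x k) `&` Om !=set0); first by exists y.
  by exists 0.
have near_yk : \forall k \near U, [/\ sol f h g (x k) (yk k), Om (yk k) &
    f (x k, yk k) < V + t k * c].
  apply: filterS near_sol => k [/Hyk [Sk Ok]]; rewrite (sol_value Sk) lte_fin.
  by split.
have [y Oy yU] : exists2 y, Om y & yk @ U --> y.
  by apply: ultra_cvg_compact => //; apply: filterS near_yk => k [].
have Sy : sol f h g xb y.
  apply: (sol_limit xU yU tcU); apply: filterS near_yk => k [[Fk _] _ fk].
  split=> // y' Fy'; apply: le_trans (ltW fk) _; rewrite lerD2r.
  exact: Sy0.2.
have RSy := RS (conj Sy Oy).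
exists y.
  split=> //; apply/dir_solP; split=> // r r0.
  have H1 : \forall k \near U, 0 < t k < r.
    have H1 : \forall k \near U, t k < r by exact: (cvgr_lt _ tU).
    by apply: filterS2 tp H1 => k -> ->.
  have H2 : \forall k \near U, `|uk k - u| < r.
    by move/cvgrPdistC_lt : uU => /(_ r r0).
  have H3 : \forall k \near U, `|yk k - y| < r /\ sol f h g (x k) (yk k).
    move/cvgrPdistC_lt : yU => /(_ r r0) yU.
    by apply: filterS2 yU near_yk => k h1 [].
  have [k [h1 h2 [h3 h4]]] : exists k, [/\ 0 < t k < r, `|uk k - u| < r &
      `|yk k - y| < r /\ sol f h g (x k) (yk k)].
    by apply: (@filter_ex _ U); apply: filterS3 H1 H2 H3.
  by exists (t k), (uk k), (yk k).
move=> b lagr_ge; rewrite leNgt; apply/negP => ltcb.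
have Fy := Sy.1.
have lagrE l : lagr_dx f h g xb y l u =
    'd f (xb, y) (u, 0) + dotv l ('d P (xb, y) (u, 0)).
  exact: lagr_dxE (f_C1.1 _) (P_C1.1 _).
have oppE : (- u, 0) = - (u, 0) :> X * Y by apply: (f_equal2 pair); rewrite ?oppr0.
have [v Tv fv] : exists2 v, tangent_cone isEq (P (xb, y)) ('d P (xb, y) (- u, v)) &
    'd f (xb, y) (- u, v) < - c.
  (* The midpoint [(b + c) / 2] leaves strict room on both sides: above [c] for the rate of [v],
     below [b] to refute the third alternative. *)
  case: (program_farkas f_C1 h_C1 g_C1 ('d P (xb, y) (- u, 0))
    ('d f (xb, y) (u, 0) - (b + c) / 2) Fy) => [[v Tv fv]|[[l [pl ol lq]]|[l Ml lq]]].
  - exists v; first by rewrite dsplit.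
    by rewrite dsplit oppE linearN; lra.
  - have [l0 Ml0] := multipliers_exist f_C1 h_C1 g_C1 Sy RSy.
    rewrite oppE linearN dotvNr oppr_gt0 in lq.
    (* Adding [s *: l] to the multiplier [l0] lowers the sensitivity by exactly the numerator, which
       carries it below [b]. *)
    pose s := (`|lagr_dx f h g xb y l0 u - b| + 1) / - dotv l ('d P (xb, y) (u, 0)).
    have s0 : 0 <= s by rewrite divr_ge0 ?addr_ge0 // oppr_ge0 ltW.
    have := lagr_ge (l0 + s *: l) _.
    have -> : lagr_dx f h g xb y (l0 + s *: l) u =
        lagr_dx f h g xb y l0 u - (`|lagr_dx f h g xb y l0 u - b| + 1).
      rewrite [LHS]lagrE dotvDl dotvZl addrA -lagrE; congr (_ + _).
      by rewrite /s invrN mulrN mulNr -mulrA mulVf ?mulr1 // ltr0_neq0.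
    have := ler_norm (lagr_dx f h g xb y l0 u - b) => H1 H2.
    have : b <= lagr_dx f h g xb y l0 u - (`|lagr_dx f h g xb y l0 u - b| + 1).
      apply: H2; apply: multipliersD => //; first exact: polarZ.
      by move=> v; rewrite dotvZl ol mulr0.
    by lra.
  - have := lagr_ge l Ml; rewrite lagrE; rewrite oppE linearN dotvNr in lq.
    by lra.
(* The steps [t k *: - uk k] lead exactly back to [xb], so the displacement tested by stability is
   0. *)
have HT : \forall k \near U, exists2 yh, feas h g (x k + t k *: - uk k) yh &
    f (x k + t k *: - uk k, yh) <= f (x k, yk k) + t k * - c.
  apply: (robinson_transport f_C1 h_C1 g_C1 (u0 := - u) Fy xU yU _ tU tp _ Tv RSy _ fv).
  - by apply: filterS near_yk => k [[]].
  - exact: cvgN.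
  - move=> e' delta' e'0 d'0; apply: nearW => k.
    by rewrite scalerN addrK subrr; exact: dir_nbhd0.
have [k [[yh Fyh Hyh] [_ _ fk]]] : exists k,
    (exists2 yh, feas h g (x k + t k *: - uk k) yh &
      f (x k + t k *: - uk k, yh) <= f (x k, yk k) + t k * - c) /\
    [/\ sol f h g (x k) (yk k), Om (yk k) & f (x k, yk k) < V + t k * c].
  by apply: (@filter_ex _ U); apply: filterS2 HT near_yk.
rewrite scalerN addrK in Fyh Hyh; have := Sy0.2 _ Fyh; rewrite -/V.
by lra.
Qed.

End DirectionalSolutions.

Lemma polar_limit {R : realType} {q : nat} {I : Type} {F : set_system I}
    {FF : ProperFilter F} (e : 'I_q -> bool) (z l : I -> 'rV[R]_q) (zb lb : 'rV[R]_q) :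
  z @ F --> zb -> l @ F --> lb -> (\forall k \near F, polar_cone e (z k) (l k)) ->
  polar_cone e zb lb.
Proof.
move=> zF lF pF i; case ei : (e i); [by left|right].
have li : (fun k => l k 0 i) @ F --> lb 0 i by exact: cvg_coord.
have lzi : (fun k => l k 0 i * z k 0 i) @ F --> lb 0 i * zb 0 i.
  by apply: cvgM => //; exact: cvg_coord.
have pi : \forall k \near F, 0 <= l k 0 i /\ l k 0 i * z k 0 i = 0.
  by apply: filterS pF => k /(_ i); rewrite ei => -[].
split; first by apply: ler_cvg_cst li _; apply: filterS pi => k [].
apply: (cvg_inj lzi); apply: (@cvg_trans _ ((fun=> 0 : R) @ F)); last exact: cvg_cst.
by apply: near_eq_cvg; apply: filterS pi => k [_ ->].
Qed.

Lemma ultra_avoid {I : Type} {F : set_system I} {FF : Filter F} (B : set I) :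
  ~ F B -> exists U, [/\ UltraFilter U, F `<=` U & U (~` B)].
Proof.
move=> nFB; pose G := within (~` B) F.
have GG : ProperFilter G.
  split; last exact: within_filter.
  move=> G0; have {}G0 : \forall x \near F, ~ B x -> False := G0.
  apply: nFB; apply: filterS G0 => y Hy.
  by apply: contrapT => nBy; exact: Hy nBy.
have [U [UU GU]] := @ultraFilterLemma _ G GG.
exists U; split=> //.
  by move=> A FA; apply: GU; apply: filterS FA.
have UB : \forall x \near F, ~ B x -> (~` B) x by exact: nearW.
exact: GU UB.
Qed.

(** * Attainment over solutions and multipliers *)

Section MultiplierCompactness.
Context {R : realType} {n m p1 p2 : nat}.
Local Notation X := 'rV[R]_n.
Local Notation Y := 'rV[R]_m.
Local Notation Q := 'rV[R]_(p1 + p2).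
Local Notation isEq := (@eq_index p1 p2).
Variables (f : X * Y -> R) (h : X * Y -> 'rV[R]_p1) (g : X * Y -> 'rV[R]_p2).
Hypotheses (f_C1 : cont_diff f) (h_C1 : cont_diff h) (g_C1 : cont_diff g).
Local Notation P := (Pmap h g).

Let P_C1 : cont_diff P := Pmap_cont_diff h_C1 g_C1.

Variables (xb u : X).

(* Along a minimizing ultrafilter the multipliers stay bounded: otherwise the
   normalized multipliers converge to a forbidden singular one. *)
Lemma min_multiplier_attained (K : set Y) (sigma : R) : compact K ->
  (forall y, K y -> feas h g xb y) ->
  (exists2 y, K y & multipliers f h g xb y !=set0) ->
  (forall y, K y -> forall l, polar_cone isEq (P (xb, y)) l ->
     (forall v, dotv l ('d P (xb, y) (0, v)) = 0) ->
     sigma * dotv l ('d P (xb, y) (u, 0)) <= 0 -> l = 0) ->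
  exists y l, [/\ K y, multipliers f h g xb y l &
    forall y' l', K y' -> multipliers f h g xb y' l' ->
      sigma * lagr_dx f h g xb y l u <= sigma * lagr_dx f h g xb y' l' u].
Proof.
move=> cK KF [y0 Ky0 [l0 Ml0]] reg.
have lagrE y l : lagr_dx f h g xb y l u =
    'd f (xb, y) (u, 0) + dotv l ('d P (xb, y) (u, 0)).
  exact: lagr_dxE (f_C1.1 _) (P_C1.1 _).
pose G := [set p : Y * Q | K p.1 /\ multipliers f h g xb p.1 p.2].
pose psi (p : Y * Q) := sigma * lagr_dx f h g xb p.1 p.2 u.
(* Sublevel sets are nested and nonempty; an ultrafilter containing them all is minimizing, even
   before [psi] is known to be bounded below. *)
pose B (p0 : Y * Q) := [set p | G p /\ psi p <= psi p0].
have G0 : G (y0, l0) by [].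
have FF : ProperFilter (filter_from G B).
  apply: filter_from_proper; last by move=> p Gp; exists p; split.
  apply: filter_from_filter; first by exists (y0, l0).
  move=> p p' Gp Gp'; have [le_pp'|lt_p'p] := leP (psi p) (psi p').
    apply: (ex_intro2 _ _ p Gp) => x [Gx xp].
    exact: (conj (conj Gx xp) (conj Gx (le_trans xp le_pp'))).
  apply: (ex_intro2 _ _ p' Gp') => x [Gx xp].
  exact: (conj (conj Gx (le_trans xp (ltW lt_p'p))) (conj Gx xp)).
have [U [UU FU]] := ultraFilterLemma FF.
have UP : ProperFilter U by exact: ultra_proper.
have UB p0 : G p0 -> \forall p \near U, psi p <= psi p0.
  by move=> Gp0; apply: FU; apply: (ex_intro2 _ _ p0 Gp0) => p [].
have UG : \forall p \near U, G p by apply: FU; apply: (ex_intro2 _ _ (y0, l0) G0) => p [].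
have [yb Kyb yU] : exists2 yb, K yb & (fun p : Y * Q => p.1) @ U --> yb.
  by apply: ultra_cvg_compact => //; apply: filterS UG => p [].
have Fyb := KF _ Kyb.
have xyU : (fun p : Y * Q => (xb, p.1)) @ U --> ((xb, yb) : X * Y).
  by apply: cvg_pair_normed => //; exact: cvg_cst.
have PU : (fun p : Y * Q => P (xb, p.1)) @ U --> P (xb, yb).
  by apply: cvg_comp xyU _; exact: (cont_diff_continuous P_C1).
have dPU w : (fun p : Y * Q => 'd P (xb, p.1) w) @ U --> 'd P (xb, yb) w.
  exact: cvg_cont_diff.
have dfU w : (fun p : Y * Q => 'd f (xb, p.1) w) @ U --> 'd f (xb, yb) w.
  exact: cvg_cont_diff.
have UM : \forall p \near U, polar_cone isEq (P (xb, p.1)) p.2 /\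
    forall v, 'd f (xb, p.1) (0, v) + dotv p.2 ('d P (xb, p.1) (0, v)) = 0.
  apply: filterS UG => p [Kp Mp].
  exact/(multipliersP f_C1 h_C1 g_C1 _ (KF _ Kp)).
have [[M UMb]|unb] := pselect (exists M : R, \forall p \near U, `|p.2| <= M).
  have [lb lU] : exists lb : Q, (fun p : Y * Q => p.2) @ U --> lb.
    exact: (ultra_cvg_rV UMb).
  exists yb, lb; split; first exact: Kyb.
    apply/(multipliersP f_C1 h_C1 g_C1 _ Fyb); split.
      by apply: polar_limit PU lU _; apply: filterS UM => p [].
    move=> v; have H : (fun p : Y * Q => 'd f (xb, p.1) (0, v) +
        dotv p.2 ('d P (xb, p.1) (0, v))) @ U -->
        'd f (xb, yb) (0, v) + dotv lb ('d P (xb, yb) (0, v)).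
      by apply: cvgD => //; exact: cvg_dotv.
    apply: (cvg_inj H); apply: (@cvg_trans _ ((fun=> 0 : R) @ U)); last exact: cvg_cst.
    by apply: near_eq_cvg; apply: filterS UM => p [_ ->].
  move=> y' l' Ky' Ml'.
  have H : psi @ U --> sigma * lagr_dx f h g xb yb lb u.
    rewrite lagrE; have -> : psi = fun p => sigma * ('d f (xb, p.1) (u, 0) +
        dotv p.2 ('d P (xb, p.1) (u, 0))) by apply/funext => p; rewrite /psi lagrE.
    by apply: cvgM; [exact: cvg_cst|apply: cvgD => //; exact: cvg_dotv].
  exact: ler_cvg H (cvg_cst _) (UB (y', l') (conj Ky' Ml')).
(* For an ultrafilter, failing to be eventually bounded by [M] means eventually exceeding [M], so
   the norms tend to infinity. *)
have big M : \forall p \near U, M < `|p.2|.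
  have [UA|] := ultra_setVsetC [set p : Y * Q | `|p.2| <= M].
    by case: unb; exists M.
  by apply: filterS => p /= /negP; rewrite -ltNge.
pose s (p : Y * Q) := `|p.2|^-1.
have s0 : \forall p \near U, 0 < s p.
  by apply: filterS (big 0) => p; rewrite /s invr_gt0.
have sU : s @ U --> (0 : R).
  apply/cvgr0Pnorm_le => e e0; apply: filterS (big e^-1) => p Hp.
  have p0 : 0 < `|p.2| by apply: lt_trans Hp; rewrite invr_gt0.
  by rewrite /s gtr0_norm ?invr_gt0 // -[leRHS]invrK lef_pV2 ?posrE ?invr_gt0 // ltW.
have norm1 : \forall p \near U, `|s p *: p.2| = 1.
  apply: filterS (big 0) => p p0.
  by rewrite normrZ gtr0_norm ?invr_gt0 // mulVf // lt0r_neq0.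
have [eta etaU] : exists eta : Q, (fun p : Y * Q => s p *: p.2) @ U --> eta.
  by apply: (ultra_cvg_rV (M := 1)); apply: filterS norm1 => p ->.
have eta1 : `|eta| = 1.
  have H : (fun p => `|s p *: p.2|) @ U --> `|eta| by exact: cvg_norm.
  apply: (cvg_inj H); apply: (@cvg_trans _ ((fun=> 1 : R) @ U)); last exact: cvg_cst.
  by apply: near_eq_cvg; apply: filterS norm1 => p ->.
suff eta0 : eta = 0 by move: eta1; rewrite eta0 normr0 => /esym/eqP; rewrite oner_eq0.
apply: (reg yb) => //.
- apply: polar_limit PU etaU _; apply: filterS2 UM s0 => p [pp _] sp.
  by apply: polarZ => //; exact: ltW.
- move=> v; have H : (fun p => s p * 'd f (xb, p.1) (0, v) +
      dotv (s p *: p.2) ('d P (xb, p.1) (0, v))) @ U -->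
      0 * 'd f (xb, yb) (0, v) + dotv eta ('d P (xb, yb) (0, v)).
    by apply: cvgD; [exact: cvgM|exact: cvg_dotv].
  rewrite mul0r add0r in H; apply: (cvg_inj H).
  apply: (@cvg_trans _ ((fun=> 0 : R) @ U)); last exact: cvg_cst.
  by apply: near_eq_cvg; apply: filterS UM => p [_ Mp]; rewrite dotvZl -mulrDr Mp mulr0.
(* Eventually [psi p <= psi (y0, l0)]. Multiplying by [s p], which tends to 0, removes the [f] term
   and the right-hand side, and leaves the sign condition in [reg]. *)
- have H : (fun p => sigma * (s p * 'd f (xb, p.1) (u, 0) +
      dotv (s p *: p.2) ('d P (xb, p.1) (u, 0)))) @ U -->
      sigma * (0 * 'd f (xb, yb) (u, 0) + dotv eta ('d P (xb, yb) (u, 0))).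
    apply: cvgM; first exact: cvg_cst.
    by apply: cvgD; [exact: cvgM|exact: cvg_dotv].
  have H' : (fun p => s p * psi (y0, l0)) @ U --> 0 * psi (y0, l0).
    by apply: cvgM => //; exact: cvg_cst.
  rewrite mul0r add0r in H; rewrite mul0r in H'.
  apply: ler_cvg H H' _; apply: filterS2 s0 (UB _ G0) => p sp psip.
  have -> : sigma * (s p * 'd f (xb, p.1) (u, 0) +
      dotv (s p *: p.2) ('d P (xb, p.1) (u, 0))) = s p * psi p.
    by rewrite /psi lagrE dotvZl; ring.
  by rewrite ler_pM2l.
Qed.

End MultiplierCompactness.

(** * Dini derivatives *)

Section DiniDerivatives.
Context {R : realType} {n : nat}.
Variables (V : 'rV[R]_n -> \bar R) (x u : 'rV[R]_n).
Local Notation F := (filter_prod (0 : R)^'+ (nbhs u)).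
Hypothesis Vfin : V x \is a fin_num.

Lemma dini_lower_le_upper : (dini_lower V x u <= dini_upper V x u)%E.
Proof.
rewrite /dini_lower /dini_upper limf_einfE limf_esupE.
apply: ge_ereal_sup => _ [A FA <-]; apply: le_ereal_inf_tmp => _ [B FB <-].
have [p [Ap Bp]] := filter_ex (filterI FA FB).
apply: (@le_trans _ _ (dini_quotient V x p)).
  by apply: ereal_inf_lbound; exists p.
by apply: ereal_sup_ubound; exists p.
Qed.

Lemma near_time_gt0 : \forall tu \near F, 0 < tu.1.
Proof.
exists ([set t : R | 0 < t], setT); last by move=> [t u'] [].
by split; [exact: nbhs_right_gt|exact: filterT].
Qed.

Lemma dini_upper_le (b : R) :
  (forall e, 0 < e -> \forall tu \near F,
     (V (x + tu.1 *: tu.2) <= V x + (tu.1 * (b + e))%:E)%E) ->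
  (dini_upper V x u <= b%:E)%E.
Proof.
move=> H; apply/lee_addgt0Pr => e e0; rewrite /dini_upper limf_esupE.
pose A := [set tu : R * 'rV[R]_n | (dini_quotient V x tu <= (b + e)%:E)%E].
apply: (@le_trans _ _ (ereal_sup (dini_quotient V x @` A))).
  apply: ereal_inf_lbound; exists A => //.
  apply: filterS2 (H e e0) near_time_gt0 => -[t u'] /= Ht t0.
  rewrite /A /dini_quotient /=; move: Ht; rewrite -(fineK Vfin).
  by rewrite lee_pdivrMr // leeBlDr // -EFinM addeC mulrC.
by apply: ge_ereal_sup => _ [p Ap <-]; rewrite -EFinD.
Qed.

(** A liminf below [c] says only that the opposite bound fails to be eventual; passing to an
    ultrafilter by [ultra_avoid] makes the strict inequality hold eventually. *)
Lemma dini_lower_witness (c : R) : (dini_lower V x u < c%:E)%E ->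
  exists U : set_system (R * 'rV[R]_n), [/\ UltraFilter U, F `<=` U &
    \forall tu \near U, (V (x + tu.1 *: tu.2) < V x + (tu.1 * c)%:E)%E].
Proof.
move=> ltc; pose A := [set tu | (c%:E <= dini_quotient V x tu)%E].
have [|U [UU FU UA]] := @ultra_avoid _ F _ A.
  move=> FA; move: ltc; apply/negP; rewrite -leNgt /dini_lower limf_einfE.
  apply: (@le_trans _ _ (ereal_inf (dini_quotient V x @` A))).
    by apply: le_ereal_inf_tmp => _ [p Ap <-].
  by apply: ereal_sup_ubound; exists A.
exists U; split=> //; have tp : \forall tu \near U, 0 < tu.1 by apply: FU; exact: near_time_gt0.
apply: filterS2 UA tp => -[t u'] /= /negP; rewrite -ltNge /dini_quotient /= => + t0.
rewrite -(fineK Vfin) lte_pdivrMr // lteBlDr // -EFinM addeC mulrC; exact.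
Qed.

End DiniDerivatives.

Lemma norm_margin {R : realDomainType} (a r : R) : ~ r <= a - (`|a - r| + 1).
Proof. by have := ler_norm (a - r); lra. Qed.

(** * Assembly of the sensitivity bounds *)

Section Sensitivity.
Context {R : realType} {n m p1 p2 : nat}.
Local Notation X := 'rV[R]_n.
Local Notation Y := 'rV[R]_m.
Local Notation Q := 'rV[R]_(p1 + p2).
Local Notation isEq := (@eq_index p1 p2).
Variables (f : X * Y -> R) (h : X * Y -> 'rV[R]_p1) (g : X * Y -> 'rV[R]_p2).
Hypotheses (f_C1 : cont_diff f) (h_C1 : cont_diff h) (g_C1 : cont_diff g).
Local Notation P := (Pmap h g).

Let P_C1 : cont_diff P := Pmap_cont_diff h_C1 g_C1.

Variables (xb u : X) (Om : set Y).
Local Notation A := (sensitivities f h g xb u).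
Local Notation V := (value f h g).
Local Notation K := (dir_sol f h g xb u `&` Om).
Local Notation lagr' y l := (lagr_dx f h g xb y l u).
Local Notation dini_filter := (filter_prod (0 : R)^'+ (nbhs u)).

Let lagrE y l : lagr' y l = 'd f (xb, y) (u, 0) + dotv l ('d P (xb, y) (u, 0)).
Proof. exact: lagr_dxE (f_C1.1 _) (P_C1.1 _). Qed.

Lemma sensitivities_sup y l : multipliers f h g xb y l ->
  (forall l', multipliers f h g xb y l' -> lagr' y l' <= lagr' y l) ->
  ereal_sup (A y) = (lagr' y l)%:E.
Proof.
move=> Ml maxl; apply/eqP; rewrite eq_le; apply/andP; split.
  by apply: ge_ereal_sup => _ [l' Ml' <-]; rewrite lee_fin; exact: maxl.
by apply: ereal_sup_ubound; exists l.
Qed.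

Lemma sensitivities_inf y l : multipliers f h g xb y l ->
  (forall l', multipliers f h g xb y l' -> lagr' y l <= lagr' y l') ->
  ereal_inf (A y) = (lagr' y l)%:E.
Proof.
move=> Ml minl; apply/eqP; rewrite eq_le; apply/andP; split.
  by apply: ereal_inf_lbound; exists l.
by apply: le_ereal_inf_tmp => _ [l' Ml' <-]; rewrite lee_fin; exact: minl.
Qed.

Hypothesis ric : restricted_inf_compactness f h g xb u Om.
Hypothesis RS : forall y, (sol f h g xb `&` Om) y -> robinson_stable h g xb y u.
Hypothesis singular0 : forall y, (sol f h g xb `&` Om) y ->
  forall l, polar_cone isEq (P (xb, y)) l ->
  (forall v, dotv l ('d P (xb, y) (0, v)) = 0) ->
  0 <= dotv l ('d P (xb, y) (u, 0)) -> l = 0.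
Hypothesis upper : forall y, (sol f h g xb `&` Om) y -> forall b e : R, 0 < e ->
  (forall l, multipliers f h g xb y l -> lagr' y l <= b) ->
  \forall tu \near dini_filter, (V (xb + tu.1 *: tu.2) <= (f (xb, y) + tu.1 * (b + e))%:E)%E.

Let dir_sol_sub y : K y -> (sol f h g xb `&` Om) y.
Proof. by move=> [[Sy _] Oy]. Qed.

Let multipliers0 y : (sol f h g xb `&` Om) y -> multipliers f h g xb y !=set0.
Proof. by move=> SOy; apply: multipliers_exist (RS SOy) => //; case: SOy. Qed.

(** The choice [sigma = -1] turns the sign condition of [min_multiplier_attained] into that of
    [singular0], so the maximum is always attained. *)
Lemma max_sensitivity y : (sol f h g xb `&` Om) y -> exists2 l, multipliers f h g xb y l &
  forall l', multipliers f h g xb y l' -> lagr' y l' <= lagr' y l.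
Proof.
move=> SOy; have [|||y' [l [-> Ml maxl]]] :=
  @min_multiplier_attained _ _ _ _ _ f h g f_C1 h_C1 g_C1 xb u [set y] (-1) (@compact_set1 _ y).
- by move=> _ ->; exact: SOy.1.1.
- by exists y => //; exact: multipliers0.
- by move=> _ -> l pl ol; rewrite mulN1r oppr_le0; exact: (singular0 SOy).
- exists l => // l' Ml'; have := maxl y l' erefl Ml'.
  by rewrite !mulN1r lerN2.
Qed.

Definition no_singular_multiplier y := forall l, polar_cone isEq (P (xb, y)) l ->
  (forall v, dotv l ('d P (xb, y) (0, v)) = 0) -> l = 0.

Lemma joint_min_sensitivity (K' : set Y) : compact K' -> K' !=set0 ->
  (forall y, K' y -> (sol f h g xb `&` Om) y /\ no_singular_multiplier y) ->
  exists y l, [/\ K' y, multipliers f h g xb y l &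
    forall y' l', K' y' -> multipliers f h g xb y' l' -> lagr' y l <= lagr' y' l'].
Proof.
move=> cK' [y0 Ky0] K'P; have [|||y [l [Ky Ml minl]]] :=
  @min_multiplier_attained _ _ _ _ _ f h g f_C1 h_C1 g_C1 xb u K' 1 cK'.
- by move=> y /K'P [[[]]].
- by exists y0 => //; apply: multipliers0; case: (K'P _ Ky0).
- by move=> y /K'P [_ ns] l pl ol _; exact: ns.
- exists y, l; split=> // y' l' Ky' Ml'; have := minl y' l' Ky' Ml'.
  by rewrite !mul1r.
Qed.

(* A nonzero singular multiplier is a recession direction of the multiplier set
   along which the sensitivity decreases. *)
Lemma min_sensitivity_dichotomy y : (sol f h g xb `&` Om) y ->
  no_singular_multiplier y \/ ereal_inf (A y) = -oo%E.
Proof.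
move=> SOy; have [|sing] := pselect (no_singular_multiplier y); [by left|right].
have [l [pl ol l0]] : exists l, [/\ polar_cone isEq (P (xb, y)) l,
    forall v, dotv l ('d P (xb, y) (0, v)) = 0 & l <> 0].
  apply: contrapT => H; apply: sing => l pl ol; apply: contrapT => l0; apply: H.
  by exists l.
have lq : dotv l ('d P (xb, y) (u, 0)) < 0.
  by rewrite ltNge; apply/negP => /(singular0 SOy pl ol).
have [l1 Ml1] := multipliers0 SOy.
have lb l2 : multipliers f h g xb y l2 -> (ereal_inf (A y) <= (lagr' y l2)%:E)%E.
  by move=> Ml2; apply: ereal_inf_lbound; exists l2.
move: lb; case: (ereal_inf (A y)) => [r| |] // lb; last first.
  by have := lb l1 Ml1; rewrite leye_eq.
(* Chosen so that the sensitivity of [l1 + s *: l] lies below a supposed finite infimum [r]. *)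
pose s := (`|lagr' y l1 - r| + 1) / - dotv l ('d P (xb, y) (u, 0)).
have s0 : 0 <= s by rewrite divr_ge0 ?addr_ge0 // oppr_ge0 ltW.
have Ms : multipliers f h g xb y (l1 + s *: l).
  apply: multipliersD => //; [by case: SOy => -[]|exact: polarZ|].
  by move=> v; rewrite dotvZl ol mulr0.
have := lb _ Ms; rewrite lee_fin [lagr' _ (_ + _)]lagrE dotvDl dotvZl addrA -lagrE.
have -> : s * dotv l ('d P (xb, y) (u, 0)) = - (`|lagr' y l1 - r| + 1).
  by rewrite /s invrN mulrN mulNr -mulrA mulVf ?mulr1 // ltr0_neq0.
by move/norm_margin.
Qed.


Let compactK : compact K.
Proof.
have [cOm _ _] := ric; apply: (subclosed_compact _ cOm) => [|y []//].
apply: closedI; first exact: dir_sol_closed.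
exact: compact_closed (@norm_hausdorff _ _) cOm.
Qed.

Let Vfin : V xb \is a fin_num. Proof. by have [] := ric. Qed.

Let value_sol y : (sol f h g xb `&` Om) y -> V xb = (f (xb, y))%:E.
Proof. by case=> Sy _; exact: sol_value. Qed.

Let witness (U : set_system (R * X)) (c : R) : UltraFilter U -> dini_filter `<=` U ->
  (\forall tu \near U, (V (xb + tu.1 *: tu.2) < V xb + (tu.1 * c)%:E)%E) ->
  exists2 y, K y & forall b,
    (forall l, multipliers f h g xb y l -> b <= lagr' y l) -> b <= c.
Proof.
move=> UU FU H.
apply: (lower_bound_witness f_C1 h_C1 g_C1 ric RS (U := U) (t := fst) (uk := snd)) => //.
- apply: cvg_trans; first by apply: cvg_app; exact: FU.
  apply: cvg_trans; first exact: cvg_fst.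
  by apply: cvg_within.
- by apply: FU; exact: near_time_gt0.
- by apply: cvg_trans; [apply: cvg_app; exact: FU|exact: cvg_snd].
Qed.

(** Restricted inf-compactness speaks only of parameters where the value does not jump up, so the
    upper estimate is needed before directional solutions can be produced. *)
Lemma dir_sol_nonempty : K !=set0.
Proof.
have [y SOy] := ric_sol_nonempty ric.
have [l Ml maxl] := max_sensitivity SOy.
have H := upper SOy ltr01 maxl.
have [U [UU FU]] := @ultraFilterLemma _ dini_filter _.
(* The upper estimate with [e = 1] gives the rate plus 1; adding 2 makes the inequality strict. *)
have [|y' Ky' _] := @witness U (lagr' y l + 2) UU FU; last by exists y'.
have tp : \forall tu \near U, 0 < tu.1 by apply: FU; exact: near_time_gt0.
apply: filterS2 (FU _ H) tp => tu H1 H2; apply: le_lt_trans H1 _.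
by rewrite (value_sol SOy) -EFinD lte_fin ltrD2l ltr_pM2l //; lra.
Qed.

Lemma dini_upper_le_max_sensitivity y : K y -> (dini_upper V xb u <= ereal_sup (A y))%E.
Proof.
move=> /dir_sol_sub SOy; have [l Ml maxl] := max_sensitivity SOy.
rewrite (sensitivities_sup Ml maxl); apply: dini_upper_le => // e e0.
apply: filterS (upper SOy e0 maxl) => tu.
by rewrite (value_sol SOy) -EFinD.
Qed.

(** Either some [y] has infimum [-oo], which is then the minimum, or by the dichotomy no [y] in [K]
    has a nonzero singular multiplier and a joint minimum over [y] and multipliers exists. The
    latter is a common lower bound, which [witness] refutes if it exceeds the Dini derivative. *)
Lemma min_sensitivity_le_dini_lower :
  exists2 b : \bar R, is_min [set ereal_inf (A y) | y in K] b & (b <= dini_lower V xb u)%E.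
Proof.
have [[y Ky infy]|noninf] := pselect (exists2 y, K y & ereal_inf (A y) = -oo%E).
  by exists -oo%E; rewrite ?leNye //; split=> [|? _]; [exists y|rewrite leNye].
have KP y : K y -> (sol f h g xb `&` Om) y /\ no_singular_multiplier y.
  move=> Ky; have SOy := dir_sol_sub Ky; split=> //.
  by case: (min_sensitivity_dichotomy SOy) => // infy; case: noninf; exists y.
have [y [l [Ky Ml minl]]] := joint_min_sensitivity compactK dir_sol_nonempty KP.
have infy := sensitivities_inf Ml (fun l' => minl y l' Ky).
exists (lagr' y l)%:E; first split.
- by exists y.
- move=> _ [y' Ky' <-]; apply: le_ereal_inf_tmp => _ [l' Ml' <-].
  by rewrite lee_fin; exact: minl.
rewrite leNgt; apply/negP => ltb.
have [c [c1 c2]] : exists c : R, (dini_lower V xb u < c%:E)%E /\ c < lagr' y l.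
  move: ltb; case: (dini_lower V xb u) => [r| |] //.
    rewrite lte_fin => ltr; exists ((r + lagr' y l) / 2); rewrite lte_fin; split; lra.
  by move=> _; exists (lagr' y l - 1); split; [rewrite ltNyr|lra].
have [U [UU FU HU]] := dini_lower_witness Vfin c1.
have [y' Ky' Hy'] := witness UU FU HU.
have : lagr' y l <= c by apply: Hy' => l' Ml'; exact: minl.
by rewrite leNgt c2.
Qed.

Lemma min_sensitivity_attained y : K y ->
  is_min (A y) (ereal_inf (A y)) \/ ereal_inf (A y) = -oo%E.
Proof.
move=> /dir_sol_sub SOy; case: (min_sensitivity_dichotomy SOy) => [ns|]; last by right.
left; have [|||y' [l [-> Ml minl]]] := @joint_min_sensitivity [set y].
- exact: compact_set1.
- by exists y.
- by move=> _ ->.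
- have minl' l' Ml' := minl y l' erefl Ml'.
  split; last by move=> a Aa; exact: ereal_inf_lbound.
  by rewrite (sensitivities_inf Ml minl'); exists l.
Qed.

Lemma max_sensitivity_attained y : K y -> is_max (A y) (ereal_sup (A y)).
Proof.
move=> /dir_sol_sub SOy; have [l Ml maxl] := max_sensitivity SOy.
split; last by move=> a Aa; exact: ereal_sup_ubound.
by rewrite (sensitivities_sup Ml maxl); exists l.
Qed.

(** With one multiplier the infimum and supremum over multipliers coincide, so a [y] minimizing the
    lower bound also closes the upper one. *)
Lemma hadamard_unique_multiplier (lb : Y -> Q) :
  (forall y, K y -> multipliers f h g xb y = [set lb y]) ->
  exists2 r : R, hadamard_derivative V xb u r &
    is_min [set lagr' y (lb y) | y in K] r.
Proof.
move=> lbE.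
have AE y : K y -> A y = [set (lagr' y (lb y))%:E].
  by move=> Ky; rewrite /sensitivities lbE // image_set1.
have [b [[y Ky <-] minb] b_le] := min_sensitivity_le_dini_lower.
rewrite AE // ereal_inf1 in minb b_le.
have := dini_upper_le_max_sensitivity Ky; rewrite AE // ereal_sup1 => le_b.
have lu := dini_lower_le_upper V xb u.
exists (lagr' y (lb y)); split.
- by apply/eqP; rewrite eq_le b_le (le_trans lu le_b).
- by apply/eqP; rewrite eq_le le_b (le_trans b_le lu).
- by exists y.
- move=> _ [y' Ky' <-]; rewrite -lee_fin; apply: minb.
  by exists y' => //; rewrite AE // ereal_inf1.
Qed.

End Sensitivity.

Theorem theorem4p3 (R : realType) (n m p1 p2 : nat)
    (f : 'rV[R]_n * 'rV[R]_m -> R)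
    (h : 'rV[R]_n * 'rV[R]_m -> 'rV[R]_p1)
    (g : 'rV[R]_n * 'rV[R]_m -> 'rV[R]_p2)
    (f_C1 : cont_diff f) (h_C1 : cont_diff h) (g_C1 : cont_diff g)
    (xb u : 'rV[R]_n) (Om : set 'rV[R]_m)
    (ric : restricted_inf_compactness f h g xb u Om)
    (lin_solvable : forall y, (sol f h g xb `&` Om) y ->
       forall d, ImDx (Pmap h g) xb y u d ->
       exists v, lin_feasible h g xb y d v)
    (no_singular : forall y, (sol f h g xb `&` Om) y ->
       forall w, Dset h g xb y u w ->
       forall mu gamma, singular_multiplier h g xb y mu gamma ->
         dotv gamma w.2 = 0 -> mu = 0 /\ gamma = 0) :
  (forall y, (sol f h g xb `&` Om) y -> robinson_stable h g xb y u)
  /\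
  ((forall y, (sol f h g xb `&` Om) y ->
    forall s : R, s = 1 \/ s = -1 ->
    forall v, (exists2 d, ImDx (Pmap h g) xb y (s *: u) d &
                          lin_feasible h g xb y d v) ->
    forall mu gamma, singular_multiplier h g xb y mu gamma ->
      dotv mu (Jxy h xb y (s *: u) v) = 0 ->
      dotv gamma (Jxy g xb y (s *: u) v) = 0 ->
      mu = 0 /\ gamma = 0) ->
   let K := dir_sol f h g xb u `&` Om in
   let V := value f h g in
   let A := sensitivities f h g xb u in
   [/\ K !=set0,
       forall y, K y ->
         (is_min (A y) (ereal_inf (A y)) \/ ereal_inf (A y) = -oo%E) /\
         is_max (A y) (ereal_sup (A y)),
       exists2 b : \bar R, is_min [set ereal_inf (A y) | y in K] b &
         (b <= dini_lower V xb u)%E,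
       (dini_lower V xb u <= dini_upper V xb u)%E &
       (dini_upper V xb u <= ereal_inf [set ereal_sup (A y) | y in K])%E]
   /\
   (forall lb : 'rV[R]_m -> 'rV[R]_(p1 + p2),
      (forall y, K y -> multipliers f h g xb y = [set lb y]) ->
      exists2 r : R, hadamard_derivative V xb u r &
        is_min [set lagr_dx f h g xb y (lb y) u | y in K] r)).
Proof.
have RS y : (sol f h g xb `&` Om) y -> robinson_stable h g xb y u.
  move=> SOy; apply: robinson_criterion => //.
  - by case: SOy => -[].
  - exact: lin_solvable.
  - exact: no_singular.
split=> // regular K V A.
have singular0 y : (sol f h g xb `&` Om) y -> forall l,
    polar_cone eq_index (Pmap h g (xb, y)) l ->
    (forall v, dotv l ('d (Pmap h g) (xb, y) (0, v)) = 0) ->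
    0 <= dotv l ('d (Pmap h g) (xb, y) (u, 0)) -> l = 0.
  move=> SOy; apply: singular_eq0 => //; first exact: lin_solvable.
  move=> v Hv; have := regular y SOy 1 (or_introl erefl) v; rewrite scale1r; exact.
have upper y : (sol f h g xb `&` Om) y -> forall b e : R, 0 < e ->
    (forall l, multipliers f h g xb y l -> lagr_dx f h g xb y l u <= b) ->
    \forall tu \near filter_prod (0 : R)^'+ (nbhs u),
      (V (xb + tu.1 *: tu.2)%R <= (f (xb, y) + tu.1 * (b + e))%:E)%E.
  move=> SOy b e e0 Hb; apply: value_upper_bound Hb => //.
  - by case: SOy.
  - exact: RS.
  - exact: lin_solvable.
  - move=> v Hv; have := regular y SOy 1 (or_introl erefl) v; rewrite scale1r; exact.
split; last exact: hadamard_unique_multiplier.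
split.
- exact: dir_sol_nonempty.
- move=> y Ky; split; first exact: (min_sensitivity_attained f_C1 h_C1 g_C1 RS).
  exact: (max_sensitivity_attained f_C1 h_C1 g_C1 RS).
- exact: min_sensitivity_le_dini_lower.
- exact: dini_lower_le_upper.
- apply: le_ereal_inf_tmp => _ [y Ky <-].
  exact: (dini_upper_le_max_sensitivity f_C1 h_C1 g_C1 ric RS).
Qed.
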